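(* Let $X, Y$ be Banach spaces with $X$ reflexive, $\Omega\subseteq X$ an open set, $F:\Omega\to Y$ an analytic function and $C\subset Y$ a nonempty closed convex cone. Suppose that $\tilde{x}\in\Omega$, that $F$ satisfies Robinson's condition at $\tilde{x}$ (i.e. $\mathrm{rge}\,T_{\tilde{x}}=Y$), that $$\gamma:=\sup_{k>1}\left\|\frac{T_{\tilde{x}}^{-1}F^{(k)}(\tilde{x})}{k!}\right\|^{\frac1{k-1}}<+\infty,\qquad \gamma>0,$$ that $B(\tilde{x},1/\gamma)\subseteq\Omega$, and that there exists $b>0$ such that $\|T_{\tilde{x}}^{-1}(-F(\tilde{x}))\|\le b$ and $\alpha:=b\gamma\le3-2\sqrt2$. Define $f:[0,1/\gamma)\to\mathbb{R}$ by $f(t):=t/(1-\gamma t)-2t+b$. Then $f$ has smallest zero $$t_*:=\left(\alpha+1-\sqrt{(\alpha+1)^2-8\alpha}\right)/(4\gamma),$$ and the sequences generated by Newton's method for solving the inclusion $F(x)\in C$ and the equation $f(t)=0$, with starting points $x_0=\tilde{x}$ and $t_0=0$ respectively, $$x_{k+1}\in x_k+\mathrm{argmin}\{\|d\| : d\in X,\ F(x_k)+F'(x_k)d\in C\},\qquad t_{k+1}=t_k-\frac{f(t_k)}{f'(t_k)},\qquad k=0,1,\ldots,$$ are well defined; $\{x_k\}$ is contained in $B(\tilde{x},t_* )$; $\{t_k\}$ is strictly increasing, is contained in $[0,t_* )$ and converges to $t_*$; and $$\|x_{k+1}-x_k\|\le t_{k+1}-t_k\quad(k=0,1,\ldots),\qquad\|x_{k+1}-x_k\|\le\frac{t_{k+1}-t_k}{(t_k-t_{k-1})^2}\|x_k-x_{k-1}\|^2\quad(k=1,2,\ldots).$$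 Moreover, $\{x_k\}$ converges to some $x_*\in B[\tilde{x},t_*]$ such that $F(x_* )\in C$, $$\|x_*-x_k\|\le t_*-t_k,\qquad t_*-t_{k+1}\le\tfrac12(t_*-t_k),\qquad k=0,1,\ldots,$$ and therefore $\{t_k\}$ converges $Q$-linearly to $t_*$ and $\{x_k\}$ converges $R$-linearly to $x_*$. Additionally, if $\alpha<3-2\sqrt2$, then for $k=1,2,\ldots$ $$\|x_{k+1}-x_k\|\le\frac{\gamma}{(1-\gamma t_* )[2(1-\gamma t_* )^2-1]}\|x_k-x_{k-1}\|^2,\qquad t_{k+1}-t_k\le\frac{\gamma}{(1-\gamma t_* )[2(1-\gamma t_* )^2-1]}(t_k-t_{k-1})^2,$$ and, as a consequence, $\{x_k\}$ and $\{t_k\}$ converge $Q$-quadratically to $x_*$ and $t_*$, respectively, in the sense that $$\limsup_{k\to\infty}\frac{\|x_*-x_{k+1}\|}{\|x_*-x_k\|^2}\le\frac{\gamma}{(1-\gamma t_* )[2(1-\gamma t_* )^2-1]},$$ $$t_*-t_{k+1}\le\frac{\gamma}{(1-\gamma t_* )[2(1-\gamma t_* )^2-1]}(t_*-t_k)^2,\qquad k=0,1,\ldots.$$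
   Context: $B(x,\delta)$ and $B[x,\delta]$ are the open and closed balls. For $z\in\Omega$, $T_z:X\rightrightarrows Y$ is the set-valued map $T_zd=F'(z)d-C$, and $T_z^{-1}:Y\rightrightarrows X$ is its inverse, $T_z^{-1}y=\{d\in X: F'(z)d-y\in C\}$. $\mathrm{rge}\,T_z=\bigcup_{d\in X}T_zd$. For a set-valued map $U$ and a point $w$, $\|Uw\|:=\inf\{\|u\|: u\in Uw\}$ (with $\|Uw\|=+\infty$ if $Uw=\varnothing$). $F^{(k)}(x)$ is the $k$-th derivative of $F$ at $x$, a $k$-multilinear map $X\times\cdots\times X\to Y$, and the composition with $T_{\tilde{x}}^{-1}$ is $T_{\tilde{x}}^{-1}F^{(k)}(x)(v_1,\ldots,v_k):=T_{\tilde{x}}^{-1}(F^{(k)}(x)(v_1,\ldots,v_k))$, with norm $$\|T_{\tilde{x}}^{-1}F^{(k)}(x)\|:=\sup\{\|T_{\tilde{x}}^{-1}(F^{(k)}(x)(v_1,\ldots,v_k))\|: v_1,\ldots,v_k\in X,\ \|v_i\|=1\}.$$ The sequence $\{x_k\}$ is any sequence obtained by choosing at each step an element of the (possibly multi-element) argmin set; ''well defined'' means that each $x_k\in\Omega$ and every argmin set is nonempty, and $f'(t_k)\neq0$ for all $k$. In the limsup, a quotient $0/0$ is read as $0$. *)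

(* Defs.v *)
(* Normed spaces are real: they are normed modules over a realType [R]. *)
From HB Require Import structures.
From mathcomp Require Import all_boot all_order all_algebra.
From mathcomp Require Import all_classical all_reals all_analysis.

Set Implicit Arguments.
Unset Strict Implicit.
Unset Printing Implicit Defensive.

Import Order.TTheory GRing.Theory Num.Theory.
Import numFieldNormedType.Exports.

Local Open Scope classical_set_scope.
Local Open Scope ring_scope.

Section Reflexive.
Context {R : realType} (X : normedModType R).

Definition in_dual (phi : X -> R^o) : Prop := linear phi /\ continuous phi.

Definition dual_norm (phi : X -> R^o) : R :=
  sup [set `|phi x| | x in closed_ball_ Num.norm (0 : X) 1].

(* [Phi] is a bounded linear functional on the dual of X; it is a function on
   all of [X -> R^o], but only its values on the dual matter. *)
Definition in_bidual (Phi : (X -> R^o) -> R) : Prop :=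
  (forall (a : R) phi psi, in_dual phi -> in_dual psi ->
     Phi (fun x => a * phi x + psi x) = a * Phi phi + Phi psi) /\
  (exists M : R, forall phi, in_dual phi -> `|Phi phi| <= M * dual_norm phi).

Definition reflexive_space : Prop :=
  forall Phi, in_bidual Phi ->
    exists x : X, forall phi, in_dual phi -> Phi phi = phi x.

End Reflexive.

Section HigherDerivatives.
Context {R : realType} {X Y : normedModType R}.

Definition multilinear k (A : ('I_k -> X) -> Y) : Prop :=
  forall (i : 'I_k) (v : 'I_k -> X),
    linear (fun u : X => A (fun j => if j == i then u else v j)).

(* For multilinear [A], the existence of such a bound is continuity. *)
Definition multilinear_bound k (A : ('I_k -> X) -> Y) (M : R) : Prop :=
  forall v : 'I_k -> X, `|A v| <= M * \prod_(i < k) `|v i|.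

Definition vcons k (h : X) (v : 'I_k -> X) : 'I_k.+1 -> X :=
  fun i => if unlift ord0 i is Some j then v j else h.

(* [A] is the Frechet derivative at [x] of the map [G] with values in the space
   of bounded [k]-linear maps with its operator norm, under the identification
   of L(X, L^k(X, Y)) with L^(k+1)(X, Y). *)
Definition is_mderive k (G : X -> ('I_k -> X) -> Y) (x : X)
    (A : ('I_k.+1 -> X) -> Y) : Prop :=
  [/\ multilinear A, exists M, multilinear_bound A M &
   forall e : R, 0 < e -> \forall h \near (0 : X),
     multilinear_bound (fun v => G (x + h) v - G x v - A (vcons h v))
                       (e * `|h|)].

(* The k-th derivative [F^(k)(x)].  By [is_mderive] it is unique where it
   exists; it is 0 at the points where F^(k-1) is not differentiable. *)
Fixpoint nderive (F : X -> Y) (k : nat) : X -> ('I_k -> X) -> Y :=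
  match k return X -> ('I_k -> X) -> Y with
  | 0%N => fun x _ => F x
  | k'.+1 => fun x => xget (fun _ => 0) [set A | is_mderive (@nderive F k') x A]
  end.

(* [F] is the sum, near [x], of a power series of continuous [k]-linear maps
   with positive radius of convergence. *)
Definition analytic_at (F : X -> Y) (x : X) : Prop :=
  exists (r M : R) (a : forall k, ('I_k -> X) -> Y),
    [/\ 0 < r,
        forall k, multilinear (a k),
        forall k, multilinear_bound (a k) (M / r ^+ k) &
        forall h : X, `|h| < r ->
          series (fun k => a k (fun _ => h)) @ \oo --> F (x + h)].

End HigherDerivatives.

Arguments nderive {R X Y} F k x v.

Section Cone.
Context {R : realType} {X Y : normedModType R}.

Definition closed_convex_cone (C : set Y) : Prop :=
  [/\ closed C, convex_set (C : set (convex_lmodType Y)) &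
      forall (a : R) y, 0 < a -> C y -> C (a *: y)].

Definition Tmap (F : X -> Y) (C : set Y) (z d : X) : set Y :=
  [set 'd F z d - c | c in C].

Definition Tinv (F : X -> Y) (C : set Y) (z : X) (y : Y) : set X :=
  [set d | C ('d F z d - y)].

Definition rge_T (F : X -> Y) (C : set Y) (z : X) : set Y :=
  \bigcup_(d in [set: X]) Tmap F C z d.

Definition robinson (F : X -> Y) (C : set Y) (z : X) : Prop :=
  rge_T F C z = [set: Y].

(* ereal_inf set0 = +oo *)
Definition set_norm (S : set X) : \bar R := ereal_inf [set `|u|%:E | u in S].

(* The supremum is taken in [0, +oo]: the point 0 only matters when X has no
   unit vector, ereal_sup set0 being -oo. *)
Definition comp_norm (U : Y -> set X) k (A : ('I_k -> X) -> Y) : \bar R :=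
  ereal_sup (0%E |` [set set_norm (U (A v)) | v in
                      [set v : 'I_k -> X | forall i, `|v i| = 1]]).

Definition smale_gamma (F : X -> Y) (C : set Y) (x : X) : \bar R :=
  ereal_sup [set poweR (comp_norm (Tinv F C x)
                          (fun v => (k`!%:R)^-1 *: nderive F k x v))
                       (k.-1%:R)^-1
            | k in [set k : nat | (1 < k)%N]].

Definition argmin_norm (S : set X) : set X :=
  [set d | S d /\ forall d', S d' -> `|d| <= `|d'|].

Definition newton_dirs (F : X -> Y) (C : set Y) (x : X) : set X :=
  argmin_norm [set d | C (F x + 'd F x d)].

(* [x 0], ..., [x n] are the first n+1 iterates of a run of Newton's method. *)
Definition newton_run (F : X -> Y) (C : set Y) (x0 : X) (n : nat)
    (x : nat -> X) : Prop :=
  x 0%N = x0 /\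
  forall k, (k < n)%N -> exists2 d, newton_dirs F C (x k) d & x k.+1 = x k + d.

Definition newton_seq (F : X -> Y) (C : set Y) (x0 : X) (x : nat -> X) : Prop :=
  forall n, newton_run F C x0 n x.

End Cone.

Section RealNewton.
Context {R : realType}.

(* Only its restriction to [0, 1/gamma) is meaningful. *)
Definition majorant (gamma b t : R) : R := t / (1 - gamma * t) - 2 * t + b.

Definition tstar (gamma b : R) : R :=
  let alpha := b * gamma in
  (alpha + 1 - Num.sqrt ((alpha + 1) ^+ 2 - 8 * alpha)) / (4 * gamma).

Definition real_newton (f : R -> R) (t0 : R) (k : nat) : R :=
  iter k (fun s => s - f s / derive1 f s) t0.

Definition smallest_zero_on (D : set R) (f : R -> R) (s : R) : Prop :=
  [/\ D s, f s = 0 & forall s', D s' -> f s' = 0 -> s <= s'].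

Definition quad_const (gamma t : R) : R :=
  gamma / ((1 - gamma * t) * (2 * (1 - gamma * t) ^+ 2 - 1)).

End RealNewton.

Section Rates.
Context {R : realType} {V : normedModType R}.

(* In \bar R, 0 / 0 = 0 and a / 0 = +oo for a > 0. *)
Definition err_quotient (p : nat) (u : nat -> V) (l : V) (k : nat) : \bar R :=
  (`|l - u k.+1|%:E / (`|l - u k| ^+ p)%:E)%E.

Definition Q_linear (u : nat -> V) (l : V) : Prop :=
  u @ \oo --> l /\ (limn_esup (err_quotient 1 u l) < 1)%E.

End Rates.

Definition R_linear {R : realType} {V : normedModType R} (u : nat -> V) (l : V)
    : Prop :=
  exists e : nat -> R^o,
    (forall k, `|l - u k| <= e k) /\ Q_linear e 0.

(* Main.v *)
Require Import Defs.
From HB Require Import structures.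
From mathcomp Require Import all_boot all_order all_algebra.
From mathcomp Require Import all_classical all_reals all_analysis.
From mathcomp Require Import fingroup perm ring lra.
Import Order.TTheory GRing.Theory Num.Theory.
Import numFieldNormedType.Exports.
Local Open Scope classical_set_scope.
Local Open Scope ring_scope.

Set Implicit Arguments.
Unset Strict Implicit.
Unset Printing Implicit Defensive.

(* With S := T_x0^-1, the functional p y := ||S y|| is sublinear; by Robinson's
   condition it is finite, hence continuous by a Baire category argument.  The
   Taylor series of F at x0 need not converge on the ball of radius 1/gamma, since
   gamma only controls the derivatives of F through p.  The bounds
   p (F^(k)(x0) (v_1, ..., v_k)) <= k! gamma^(k-1) |v_1| ... |v_k| are therefore
   propagated along each segment starting at x0 by continuation: where they hold for
   all k with right-hand sides the derivatives of the majorant f, the local Taylor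
   expansion pushes them a bit further.  In particular p (F''(x0 + h)(u, v)) is at
   most f''(|h|) |u| |v|.  Integrating once and perturbing S by successive
   approximations gives ||T_x^-1 y|| <= p y / |f'(|x - x0|)|; integrating twice bounds
   the Newton residual by that of f.  Reflexivity makes the argmin sets nonempty: an
   ultrafilter limit of a minimizing family is an element of the bidual.

   In the scalar part, a = 1 - gamma t and s = 1 - gamma t_* linearize everything:
   f t = (t_* - t)(2 a s - 1)/(a s), and t' = t - f t / f' t satisfies
   a' - s = (a - s)^2 / (s (2 a^2 - 1)), where alpha <= 3 - 2 sqrt 2 means
   2 s^2 >= 1. *)

(** * Mean value inequalities and continuation *)

(** [p] is not symmetric and vanishes on all of [- C], so a bound on [p y] controls neither
    [p (- y)] nor the norm of [y]. Every mean value inequality therefore carries its sign: the minus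
    of a difference goes inside the multilinear maps, as in [vcons (- d) vnil].

    The residual estimate rests on a choice of right-hand side. Suppose F x + F'(x) d is in [C], and
    D solves F'(x + d) D - y in [C] with y = - (F (x + d) - F x - F'(x) d). Adding the two
    memberships in the convex cone gives F (x + d) + F'(x + d) D in [C]. So the next minimal
    direction is at most as long as D, and y is of second order in d; the size of F (x + d) never
    enters. If |x - x0| <= t and |d| <= t' - t, the resulting bound with t' - t in place of |d| is
    exactly the Newton step of f from t' = t - f t / f' t.

    In the critical case alpha = 3 - 2 sqrt 2 the derivative of f vanishes at [ts] and the
    perturbation bound degenerates there. It is used only at points with |x - x0| < [ts]; that F
    maps the limit into [C] comes from closedness of [C]. *)

Lemma leq_bin_exp2 n m : ('C(n, m) <= 2 ^ n)%N.
Proof.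
have [mn|nm] := leqP m n; last by rewrite bin_small.
rewrite -[2%N]/(1 + 1)%N expnDn (bigD1 (inord m)) //= inordK ?ltnS //.
by rewrite !exp1n !muln1 leq_addr.
Qed.

(** The infimum [m] of the counterexamples satisfies [Q], by [Q a] or by the limit clause. If
    [m < b], the step clause leaves no counterexample just to the right of [m]; if [m = b], the only
    candidate is [m] itself. *)
Lemma real_induction (R : realType) (a b : R) (Q : R -> Prop) :
  Q a ->
  (forall s, a <= s < b -> Q s ->
     exists2 d : R, 0 < d & forall s', s < s' < s + d -> s' <= b -> Q s') ->
  (forall s, a < s <= b -> (forall s', a <= s' < s -> Q s') -> Q s) ->
  forall s, a <= s <= b -> Q s.
Proof.
move=> Qa Qstep Qlim s1 /andP[as1 s1b]; apply: contrapT => nQs1.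
pose S := [set s | a <= s <= b /\ ~ Q s].
have Ss1 : S s1 by split=> //; rewrite as1 s1b.
have lbS : lbound S a by move=> s [/andP[]].
have hiS : has_inf S by split; [exists s1 | exists a].
set m := inf S.
have am : a <= m by apply: lb_le_inf => //; exists s1.
have ms1 : m <= s1 by apply: ge_inf => //; exists a.
have Qlt s' : a <= s' < m -> Q s'.
  move=> /andP[as' s'm]; apply: contrapT => nQ.
  have : m <= s'.
    apply: ge_inf; first by exists a.
    by split=> //; rewrite as' (le_trans (ltW s'm)) // (le_trans ms1).
  by rewrite leNgt s'm.
have Qm : Q m.
  have [->//|am'] := eqVneq m a.
  by apply: Qlim => //; rewrite lt_def am' am (le_trans ms1).
have [mb|bm] := ltP m b; last first.
  by apply: nQs1; have -> : s1 = m by apply/le_anti; rewrite ms1 (le_trans s1b).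
have [|d d0 Hd] := Qstep m _ Qm; first by rewrite am.
have [s [/andP[as_ sb] nQs] sm] := inf_adherent d0 hiS.
have ms : m <= s by apply: ge_inf; [exists a | split=> //; rewrite as_ sb].
apply: nQs.
have [<-//|nms] := eqVneq m s.
by apply: Hd => //; rewrite lt_def eq_sym nms ms.
Qed.

(** The little-o is spelled out because a sublinear functional is applied to the expansion itself:
    the composite with the curve need not be differentiable. *)
Definition curve_deriv (R : realType) (Y : normedModType R) (u : R -> Y) (s : R)
  (l : Y) := forall e : R, 0 < e ->
  \forall h \near (0 : R), `|u (s + h) - u s - h *: l| <= e * `|h|.

Section CurveDeriv.
Context {R : realType}.

Lemma is_derive_curve_deriv (f : R -> R) (s l : R) :
  is_derive s 1 f l -> curve_deriv (f : R -> R^o) s l.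
Proof.
move=> [fd <-] e e0.
have /cvgrPdist_le/(_ e e0)/nbhs_ballP[d /= d0 H] := fd.
apply/nbhs_norm0P; exists d => // h hd.
have [->|h0] := eqVneq h 0; first by rewrite addr0 subrr scale0r subrr !normr0 mulr0.
have := H h; rewrite -ball_normE /= sub0r normrN => /(_ hd h0).
rewrite /GRing.scale /= mulr1 (addrC h s) => He.
rewrite -[f (s + h) - f s](mulVKf h0) -mulrBr normrM mulrC.
by rewrite ler_wpM2r // distrC.
Qed.

Lemma curve_derivD (Y : normedModType R) (u v : R -> Y) s l m :
  curve_deriv u s l -> curve_deriv v s m ->
  curve_deriv (fun t => u t + v t) s (l + m).
Proof.
move=> hu hv e e0; have e20 : 0 < e / 2 by rewrite divr_gt0.
near=> h.
have Hu : `|u (s + h) - u s - h *: l| <= e / 2 * `|h| by near: h; exact: hu.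
have Hv : `|v (s + h) - v s - h *: m| <= e / 2 * `|h| by near: h; exact: hv.
have -> : u (s + h) + v (s + h) - (u s + v s) - h *: (l + m) =
    (u (s + h) - u s - h *: l) + (v (s + h) - v s - h *: m).
  by rewrite scalerDr !opprD [X in X + _]addrACA [LHS]addrACA.
apply: le_trans (ler_normD _ _) _; apply: le_trans (lerD Hu Hv) _.
by rewrite -mulrDl -splitr.
Unshelve. all: by end_near. Qed.

Lemma curve_deriv_cst (Y : normedModType R) (y : Y) s : curve_deriv (fun=> y) s 0.
Proof.
move=> e e0; near=> h.
by rewrite subrr scaler0 subr0 normr0 mulr_ge0 // ltW.
Unshelve. all: by end_near. Qed.

Lemma curve_deriv_lin (Y : normedModType R) (y : Y) s : curve_deriv (fun t => t *: y) s y.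
Proof.
move=> e e0; near=> h.
by rewrite scalerDl -addrA -opprD subrr normr0 mulr_ge0 // ltW.
Unshelve. all: by end_near. Qed.

Lemma curve_derivN (Y : normedModType R) (u : R -> Y) s l :
  curve_deriv u s l -> curve_deriv (fun t => - u t) s (- l).
Proof.
move=> hu e e0; near=> h.
rewrite scalerN -!opprD normrN; near: h; exact: hu.
Unshelve. all: by end_near. Qed.

Lemma curve_deriv_lip (Y : normedModType R) (u : R -> Y) s l :
  curve_deriv u s l ->
  exists2 d : R, 0 < d & forall h, `|h| < d -> `|u (s + h) - u s| <= (`|l| + 1) * `|h|.
Proof.
move=> /(_ 1 ltr01)/nbhs_norm0P[d d0 H]; exists d => // h /H.
rewrite mul1r => Hh; rewrite -(subrK (h *: l) (u (s + h) - u s)).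
apply: (le_trans (ler_normD _ _)); rewrite normrZ mulrDl mul1r addrC (mulrC `|l|).
by rewrite lerD2l.
Qed.

End CurveDeriv.

Lemma is_derive_monomial (R : realType) (a c t : R) n :
  is_derive t 1 (fun s => c * (s - a) ^+ n.+1) (c * (n.+1%:R * (t - a) ^+ n)).
Proof.
have -> : (fun s => c * (s - a) ^+ n.+1) = c *: (@id R - cst a) ^+ n.+1.
  by apply/funext => s; rewrite !fctE.
by apply: is_derive_eq; rewrite subr0 /GRing.scale /= mulr1.
Qed.

Lemma is_derive_invr_exp (R : realType) (w c t : R) n : 1 - w * t != 0 ->
  is_derive t 1 (fun s => c / (1 - w * s) ^+ n) (c * n%:R * w / (1 - w * t) ^+ n.+1).
Proof.
move=> h.
have d0 : is_derive t 1 (fun y : R => 1 - w * y) (- w).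
  have -> : (fun y => 1 - w * y) = cst 1 - w *: @id R by [].
  by apply: is_derive_eq; rewrite sub0r /GRing.scale /= mulr1.
have d : is_derive t 1 (fun y : R => (1 - w * y)^-1) (w / (1 - w * t) ^+ 2).
  apply: DeriveDef; first exact: derivableV.
  by rewrite deriveV // derive_val /GRing.scale /= mulNr mulrN opprK mulrC.
have -> : (fun s => c / (1 - w * s) ^+ n) = c *: (fun y : R => (1 - w * y)^-1) ^+ n.
  by apply/funext => s; rewrite !fctE /= -exprVn.
apply: is_derive_eq; rewrite /GRing.scale /= exprVn.
case: n => [|n] /=.
  by rewrite mulr0 !mul0r mulr0.
by rewrite !exprS; field; rewrite h expf_neq0.
Qed.

Section Sublinear.
Context {R : realType} {Y : normedModType R} (p : Y -> R) (P : R).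
Hypothesis p_sub : forall y z, p (y + z) <= p y + p z.
Hypothesis p_hom : forall (c : R) y, 0 <= c -> p (c *: y) = c * p y.
Hypothesis P_ge0 : 0 <= P.
Hypothesis p_bd : forall y, p y <= P * `|y|.

Lemma sublinear_left_limit (u : R -> Y) (psi : R -> R) s l m (a : R) :
  curve_deriv u s l -> curve_deriv (psi : R -> R^o) s m -> a < s ->
  (forall s', a <= s' < s -> p (u s') <= psi s') -> p (u s) <= psi s.
Proof.
move=> /curve_deriv_lip[d1 d10 H1] /curve_deriv_lip[d2 d20 H2] as_ H.
apply/ler_addgt0Pr => /= e e0.
(* [M] adds the rates at which [p] along [u] and [psi] can change near [s], so moving back by
   [h <= e / M] costs at most [e]. *)
pose M := P * (`|l| + 1) + (`|m| + 1).
have M0 : 0 < M by rewrite /M ltr_wpDl // ?mulr_ge0 ?addr_ge0 // ltr_wpDl.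
pose h := Num.min (Num.min (d1 / 2) (d2 / 2)) (Num.min (s - a) (e / M)).
have h0 : 0 < h by rewrite !lt_min !divr_gt0 // subr_gt0 as_.
have hd1 : `|- h| < d1.
  rewrite normrN gtr0_norm // !gt_min; apply/orP; left; apply/orP; left.
  by rewrite ltr_pdivrMr // ltr_pMr // ltr1n.
have hd2 : `|- h| < d2.
  rewrite normrN gtr0_norm // !gt_min; apply/orP; left; apply/orP; right.
  by rewrite ltr_pdivrMr // ltr_pMr // ltr1n.
have hsa : h <= s - a by rewrite !ge_min lexx /= orbT.
have heM : h <= e / M by rewrite !ge_min lexx /= !orbT.
have Hsh : p (u (s - h)) <= psi (s - h).
  by apply: H; rewrite lerBrDl -lerBrDr hsa /= ltrBlDr ltrDl.
have {}H1 := H1 _ hd1; have {}H2 := H2 _ hd2.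
rewrite normrN (gtr0_norm h0) in H1; rewrite normrN (gtr0_norm h0) in H2.
have E1 : p (u s) <= p (u (s - h)) + P * ((`|l| + 1) * h).
  rewrite -[in X in X <= _](subrK (u (s - h)) (u s)) addrC.
  apply: le_trans (p_sub _ _) _; rewrite lerD2l.
  by apply: le_trans (p_bd _) _; rewrite ler_wpM2l // distrC.
have E2 : psi (s - h) <= psi s + (`|m| + 1) * h.
  by rewrite -lerBlDl; apply: le_trans H2; exact: ler_norm.
have E3 : h * M <= e by rewrite -ler_pdivlMr.
by rewrite /M in E3; lra.
Qed.

(** Adding the slack [e * (s - a)] to [psi] leaves room [e * h] to the right of a point where the
    bound holds; half of it absorbs the remainder of [u], half that of [psi]. [real_induction]
    carries the bound to [b], and then [e] tends to 0. *)
Lemma sublinear_mvi (u u' : R -> Y) (psi psi' : R -> R) (a b : R) :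
  (forall s, a <= s <= b -> curve_deriv u s (u' s)) ->
  (forall s, a <= s <= b -> curve_deriv (psi : R -> R^o) s (psi' s)) ->
  p (u a) <= psi a -> (forall s, a <= s <= b -> p (u' s) <= psi' s) ->
  forall s, a <= s <= b -> p (u s) <= psi s.
Proof.
move=> du dpsi ua u'psi' s sab; apply/ler_addgt0Pr => e' e'0.
have ba : 0 <= b - a by rewrite subr_ge0; case/andP: sab => x y; exact: le_trans x y.
have [e e0 ee] : exists2 e : R, 0 < e & e * (b - a) <= e'.
  exists (e' / (b - a + 1)); first by rewrite divr_gt0 // ltr_wpDl.
  by rewrite mulrAC ler_pdivrMr ?ltr_wpDl // ler_pM2l // lerDl.
suff : p (u s) <= psi s + e * (s - a).
  move/le_trans; apply; rewrite lerD2l; apply: le_trans ee; rewrite ler_pM2l //.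
  by rewrite lerD2r; case/andP: sab.
have dpsie t : a <= t <= b ->
    curve_deriv (fun t => psi t + e * (t - a) : R^o) t (psi' t + e).
  move=> tab; apply: curve_derivD; first exact: dpsi.
  move=> eta eta0; near=> h.
  rewrite -mulrBr opprB addrA subrK [t + h]addrC addrK [h *: _]mulrC subrr normr0.
  by rewrite mulr_ge0 // ltW.
apply: (@real_induction R a b (fun s => p (u s) <= psi s + e * (s - a))) => //.
- by rewrite subrr mulr0 addr0.
- move=> t /andP[at_ tb] pt.
  have tab : a <= t <= b by rewrite at_ ltW.
  have e20 : 0 < e / 2 by rewrite divr_gt0.
  (* With this tolerance [p] of the remainder of [u] is at most [e / 2 * h]; the [+ 1] covers
     [P = 0]. *)
  have eP0 : 0 < e / 2 / (P + 1) by rewrite divr_gt0 // ltr_wpDl.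
  have /nbhs_norm0P[d1 d10 H1] := du t tab _ eP0.
  have /nbhs_norm0P[d2 d20 H2] := dpsi t tab _ e20.
  exists (Num.min d1 d2); first by rewrite lt_min d10.
  move=> s' /andP[ts' s'd] _; pose h := s' - t.
  have h0 : 0 < h by rewrite subr_gt0.
  have s'E : s' = t + h by rewrite /h addrC subrK.
  move: s'd; rewrite s'E ltrD2l lt_min => /andP[hd1 hd2].
  have /H1 {}H1 : `|h| < d1 by rewrite gtr0_norm.
  have /H2 {}H2 : `|h| < d2 by rewrite gtr0_norm.
  rewrite (gtr0_norm h0) in H1; rewrite (gtr0_norm h0) in H2.
  have E1 : p (u (t + h)) <= p (u t) + h * p (u' t) + P * (e / 2 / (P + 1) * h).
    have -> : u (t + h) = u t + h *: u' t + (u (t + h) - u t - h *: u' t).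
      by rewrite -addrA [h *: _ + _]addrC subrK addrC subrK.
    apply: le_trans (p_sub _ _) _; apply: lerD.
      by apply: le_trans (p_sub _ _) _; rewrite p_hom // ltW.
    by apply: le_trans (p_bd _) _; rewrite ler_wpM2l.
  have E2 : P * (e / 2 / (P + 1) * h) <= e / 2 * h.
    rewrite mulrA ler_pM2r // mulrA ler_pdivrMr ?ltr_wpDl // mulrC ler_pM2l //.
    by rewrite lerDl.
  have E3 : psi t + h * psi' t - e / 2 * h <= psi (t + h).
    rewrite lerBlDr -lerBlDl; move: H2; rewrite /GRing.scale /=.
    move=> H2; have : psi t + h * psi' t - psi (t + h) <= e / 2 * h.
      apply: le_trans H2; rewrite -normrN; apply: le_trans (ler_norm _).
      by rewrite !opprD !opprK addrC addrAC addrA addrAC (addrC _ (h * _)) addrC.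
    lra.
  have E4 : h * p (u' t) <= h * psi' t by rewrite ler_pM2l //; exact: u'psi'.
  lra.
- move=> t /andP[at_ tb] H.
  have tab : a <= t <= b by rewrite tb ltW.
  exact: (sublinear_left_limit (du t tab) (dpsie t tab) at_ H).
Unshelve. all: by end_near. Qed.

(** Repeated integration from the top order down: each use of [sublinear_mvi] lowers the order by
    one and integrates the excess, which turns [C] into [C * (s - a) ^+ N / N!]. *)
Lemma sublinear_taylor (g : nat -> R -> Y) (phi : nat -> R -> R) (a b C : R) :
  (forall k s, a <= s <= b -> curve_deriv (g k) s (g k.+1 s)) ->
  (forall k s, a <= s <= b -> curve_deriv (phi k : R -> R^o) s (phi k.+1 s)) ->
  (forall k, p (g k a) <= phi k a) ->
  forall N k, (forall s, a <= s <= b -> p (g (k + N)%N s) <= phi (k + N)%N s + C) ->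
  forall s, a <= s <= b -> p (g k s) <= phi k s + C * (s - a) ^+ N / N`!%:R.
Proof.
move=> dg dphi ga; elim=> [|N IH] k H s sab.
  by rewrite expr0 mulr1 divr1; have := H s sab; rewrite addn0.
apply: (@sublinear_mvi (g k) (g k.+1)
  (fun s => phi k s + C * (s - a) ^+ N.+1 / N.+1`!%:R)
  (fun s => phi k.+1 s + C * (s - a) ^+ N / N`!%:R) a b) => //.
- exact: dg.
- move=> t tab; apply: curve_derivD; first exact: dphi.
  apply: is_derive_curve_deriv.
  have N0 : N.+1%:R != 0 :> R by rewrite pnatr_eq0.
  have f0 : N`!%:R != 0 :> R by rewrite pnatr_eq0 -lt0n fact_gt0.
  have -> : (fun s => C * (s - a) ^+ N.+1 / N.+1`!%:R) =
      (fun s => C / N.+1`!%:R * (s - a) ^+ N.+1) by apply/funext => ?; rewrite mulrAC.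
  apply: is_derive_eq (is_derive_monomial _ _ _ _) _.
  by rewrite factS natrM; field; rewrite f0 nat1r N0.
- by rewrite subrr expr0n /= mulr0 mul0r addr0.
- apply: IH => t tab; rewrite addSnnS; exact: H.
Qed.

(* Beyond a point [s] reached by the bounds, [p (g (k + N))] exceeds [phi (k + N)] by at
   most a constant of order [(k + N)! L ^ (k + N)]; integrating [N] times divides it by
   [N!], and the excess vanishes as [N] grows. *)
Lemma sublinear_continuation (g : nat -> R -> Y) (phi : nat -> R -> R) (a b : R) :
  (forall k s, a <= s <= b -> curve_deriv (g k) s (g k.+1 s)) ->
  (forall k s, a <= s <= b -> curve_deriv (phi k : R -> R^o) s (phi k.+1 s)) ->
  (forall k s, a <= s <= b -> 0 <= phi k s) ->
  (forall s, a <= s <= b -> exists d M L, [/\ 0 < d, 0 <= M, 0 <= L &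
     forall k s', s <= s' < s + d -> s' <= b -> `|g k s'| <= M * k`!%:R * L ^+ k]) ->
  (forall k, p (g k a) <= phi k a) ->
  forall k s, a <= s <= b -> p (g k s) <= phi k s.
Proof.
move=> dg dphi phi0 loc ga k s sab; move: s sab k.
apply: real_induction => //; last first.
  move=> s /andP[as_ sb] H k; have sab : a <= s <= b by rewrite sb ltW.
  by apply: (sublinear_left_limit (dg k s sab) (dphi k s sab) as_) => s' /H.
move=> s /andP[as_ sb] gs.
have sab : a <= s <= b by rewrite as_ ltW.
have [d [M [L [d0 M0 L0 H]]]] := loc s sab.
(* The second radius gives [2 * L * h <= 1 / 2], the ratio of the geometric sequence to which the
   excess is compared. *)
exists (Num.min (d / 2) ((4 * (L + 1))^-1)).
  by rewrite lt_min divr_gt0 //= invr_gt0 mulr_gt0 // ltr_wpDl.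
move=> s' /andP[ss' s'd] s'b k; pose h := s' - s.
have h0 : 0 < h by rewrite subr_gt0.
have s'E : s' = s + h by rewrite /h addrC subrK.
move: s'd; rewrite {1}s'E ltrD2l lt_min => /andP[hd hL].
have Lh : 2 * L * h <= 2^-1.
  have L1 : 0 < L + 1 by rewrite ltr_wpDl.
  have := mulr_ge0 L0 (ltW h0).
  have : h * (4 * (L + 1)) < 1 by rewrite -ltr_pdivlMr ?mulr_gt0 // div1r.
  by nra.
pose c := P * (M * k`!%:R * (2 * L) ^+ k).
have c0 : 0 <= c by rewrite !mulr_ge0 // exprn_ge0 // mulr_ge0.
have HN N : p (g k s') <= phi k s' + c * 2^-1 ^+ N.
  pose C := P * (M * (k + N)`!%:R * L ^+ (k + N)).
  have C0 : 0 <= C by rewrite !mulr_ge0 // exprn_ge0.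
  have sub t : s <= t <= s' -> a <= t <= b.
    by case/andP => st ts'; rewrite (le_trans as_ st) (le_trans ts' s'b).
  have := @sublinear_taylor g phi s s' C
    (fun k t h => dg k t (sub t h)) (fun k t h => dphi k t (sub t h)) gs N k.
  move=> /(_ _ s') T; apply: le_trans (T _ _) _.
  - move=> t /[dup] /andP[st ts'] /sub tab.
    (* Since [phi] is nonnegative, the local norm bound alone shows that the excess at order [k + N]
       is at most [C]. *)
    apply: le_trans (p_bd _) _; rewrite -[X in X <= _]add0r lerD ?phi0 //.
    rewrite ler_wpM2l // H ?(le_trans ts') //.
    rewrite st (le_lt_trans ts') // s'E ltrD2l (lt_trans hd) //.
    by rewrite ltr_pdivrMr // ltr_pMr // ltr1n.
  - by rewrite lexx ltW.
  - rewrite lerD2l /C /c -/h.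
    (* After division by [N!], the factorial of [k + N] leaves [k!] times a binomial coefficient at
       most [2 ^ (k + N)]; this is the origin of [2 * L]. *)
    have binE : (k + N)`!%:R = 'C(k + N, N)%:R * (k`!%:R * N`!%:R) :> R.
      by rewrite -!natrM -(@bin_fact (k + N) N) ?leq_addl // addnK [(N`! * _)%N]mulnC.
    have bin2 : 'C(k + N, N)%:R <= 2 ^+ (k + N) :> R.
      by rewrite -natrX ler_nat leq_bin_exp2.
    have f0 : N`!%:R != 0 :> R by rewrite pnatr_eq0 -lt0n fact_gt0.
    have -> : P * (M * (k + N)`!%:R * L ^+ (k + N)) * h ^+ N / N`!%:R =
        (P * M * k`!%:R * L ^+ k * (L * h) ^+ N) * 'C(k + N, N)%:R.
      by rewrite binE exprD exprMn; field.
    have LhN0 : 0 <= P * M * k`!%:R * L ^+ k * (L * h) ^+ N.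
      by rewrite !mulr_ge0 // ?exprn_ge0 // mulr_ge0 // ltW.
    apply: le_trans (ler_wpM2l LhN0 bin2) _.
    have -> : P * M * k`!%:R * L ^+ k * (L * h) ^+ N * 2 ^+ (k + N) =
      P * (M * k`!%:R * (2 * L) ^+ k) * (2 * L * h) ^+ N.
      by rewrite exprD !exprMn; ring.
    rewrite ler_wpM2l // lerXn2r // nnegrE ?invr_ge0 ?ler0n // !mulr_ge0 //.
    exact: ltW.
have cvg0 : (fun N => phi k s' + c * 2^-1 ^+ N) @ \oo --> phi k s' + c * 0.
  apply: cvgD; first exact: cvg_cst.
  apply: cvgMr; apply: cvg_expr; rewrite ger0_norm ?invr_ge0 ?ler0n //.
  by rewrite invf_lt1 // ltr1n.
rewrite mulr0 addr0 in cvg0.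
rewrite -(cvg_lim _ cvg0) //; apply: limr_ge; first exact: cvgP cvg0.
by near=> N; exact: HN.
Unshelve. all: by end_near. Qed.

End Sublinear.

(** * Linear minorants and minimal norm in reflexive spaces *)

Definition sublinear (R : realType) (V : lmodType R) (p : V -> R) : Prop :=
  (forall x y, p (x + y) <= p x + p y) /\
  (forall (c : R) x, 0 <= c -> p (c *: x) = c * p x).

Section SublinearInf.
Context {R : realType} {V : lmodType R}.
Implicit Types (p q : V -> R) (G : V -> set R).

Lemma sublinear0 p : sublinear p -> p 0 = 0.
Proof. by move=> [_ /(_ 0 0 (lexx 0))]; rewrite scale0r mul0r. Qed.

Lemma sublinear_ge p x : sublinear p -> - p (- x) <= p x.
Proof.
by move=> sp; rewrite -subr_ge0 opprK -(sublinear0 sp) -(subrr x); exact: sp.1.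
Qed.

(** Common ground of four constructions: the competitor to a minimal functional, the infimum of a
    chain, the functional behind separation, and [proc_norm]. The lower bound [lo] keeps the infima
    real, and one inequality for scaling suffices because it also applies to the inverse scalar. *)
Lemma sublinear_inf G (lo : V -> R) :
  (forall x, G x !=set0) -> (forall x, lbound (G x) (lo x)) ->
  (forall x y r s, G x r -> G y s -> exists2 u, G (x + y) u & u <= r + s) ->
  (forall (c : R) x r, 0 < c -> G x r -> exists2 u, G (c *: x) u & u <= c * r) ->
  lbound (G 0) 0 -> (exists2 u, G 0 u & u <= 0) ->
  sublinear (fun x => inf (G x)).
Proof.
move=> G0 Glb GD GZ lb0 [u Gu u0].
have hlb x : has_lbound (G x) by exists (lo x); exact: Glb.
have le_inf' x r : G x r -> inf (G x) <= r by move=> Gr; apply: ge_inf.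
have inf0 : inf (G 0) = 0.
  apply/le_anti/andP; split; first exact: le_trans (le_inf' _ _ Gu) u0.
  by apply: lb_le_inf => //; exists u.
have leZ (c : R) x : 0 < c -> inf (G (c *: x)) <= c * inf (G x).
  move=> c0; rewrite -ler_pdivrMl //; apply: lb_le_inf => // r Gr.
  have [v Gv vr] := GZ c x r c0 Gr.
  by rewrite ler_pdivrMl //; exact: le_trans (le_inf' _ _ Gv) vr.
split=> [x y|c x].
  rewrite -lerBlDr; apply: lb_le_inf => // r Gr.
  rewrite lerBlDr -lerBlDl; apply: lb_le_inf => // s Gs.
  by rewrite lerBlDl; have [v Gv /(le_trans (le_inf' _ _ Gv))] := GD x y r s Gr Gs.
rewrite le_eqVlt => /predU1P[<-|c0]; first by rewrite scale0r mul0r inf0.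
apply/le_anti/andP; split; first exact: leZ.
rewrite -ler_pdivlMl // -{1}[x](scalerK (lt0r_neq0 c0)).
by apply: leZ; rewrite invr_gt0.
Qed.

(* The competitor is [z |-> inf_(t >= 0) (q (z + t y) - t q y)]. *)
Lemma sublinear_minimal_additive q :
  sublinear q ->
  (forall q', sublinear q' -> (forall x, q' x <= q x) -> forall x, q x <= q' x) ->
  forall x y, q (x + y) = q x + q y.
Proof.
move=> sq qmin x y; apply/le_anti; rewrite sq.1 /=.
pose G z := [set r | exists2 t : R, 0 <= t & r = q (z + t *: y) - t * q y].
have Glb z : lbound (G z) (- q (- z)).
  move=> _ [t t0 ->]; rewrite -sq.2 // lerBrDl lerBlDr.
  by have := sq.1 (z + t *: y) (- z); rewrite addrAC subrr add0r.
have hlb z : has_lbound (G z) by exists (- q (- z)).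
have G1 z : G z (q z) by exists 0; rewrite // scale0r mul0r subr0 addr0.
have sG : sublinear (fun z => inf (G z)).
  apply: (@sublinear_inf G (fun z => - q (- z))) => //.
  - by move=> z; exists (q z).
  - move=> z w _ _ [t t0 ->] [s s0 ->].
    exists (q (z + w + (t + s) *: y) - (t + s) * q y).
      by exists (t + s); rewrite // addr_ge0.
    rewrite addrACA -opprD -mulrDl lerD2r scalerDl addrACA; exact: sq.1.
  - move=> c z _ c0 [t t0 ->].
    exists (q (c *: z + (c * t) *: y) - (c * t) * q y).
      by exists (c * t); rewrite // mulr_ge0 // ltW.
    by rewrite mulrBr -scalerA -scalerDr sq.2 ?mulrA // ltW.
  - by have := Glb 0; rewrite oppr0 (sublinear0 sq) oppr0.
  - by exists (q 0) => //; rewrite (sublinear0 sq).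
have : q x <= inf (G x).
  by apply: (qmin _ sG) => z; apply: ge_inf.
have /le_trans H : inf (G x) <= q (x + y) - q y.
  by apply: ge_inf => //; exists 1; rewrite ?scale1r ?mul1r.
by move=> /le_trans/(_ (H _ (lexx _))); rewrite lerBrDr.
Qed.

(** Hahn-Banach by Zorn's lemma on the sublinear functionals below [p], ordered downwards. A chain
    is bounded by its pointwise infimum, which is finite because every member is at least
    [- p (- x)] at [x]. A minimal element is additive, hence odd, hence linear. *)
Lemma exists_linear_minorant p : sublinear p ->
  exists phi : V -> R, [/\ forall x y, phi (x + y) = phi x + phi y,
    forall (c : R) x, phi (c *: x) = c * phi x & forall x, phi x <= p x].
Proof.
move=> sp; pose T := {q : V -> R | sublinear q /\ forall x, q x <= p x}.
pose t0 : T := exist _ p (conj sp (fun x => lexx (p x))).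
pose Rel (q r : T) := `[< forall x, sval r x <= sval q x >].
have [|||[q [sq qp]] qmin] := @ZL_preorder T t0 Rel.
- by move=> t; apply/asboolP.
- move=> r s t /asboolP rs /asboolP st; apply/asboolP => x.
  exact: le_trans (st x) (rs x).
- move=> A tA; have [[a0 Aa0]|A0] := pselect (A !=set0); last first.
    by exists t0 => s As; case: A0; exists s.
  pose G x := [set r | exists2 s : T, A s & r = sval s x].
  have Glb x : lbound (G x) (- p (- x)).
    move=> _ [[s [ss sp']] _ ->] /=; apply: le_trans (sublinear_ge x ss).
    by rewrite lerN2.
  have hlb x : has_lbound (G x) by exists (- p (- x)).
  have G1 x : G x (sval a0 x) by exists a0.
  have sG : sublinear (fun x => inf (G x)).
    apply: (@sublinear_inf G (fun x => - p (- x))) => //.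
    - by move=> x; exists (sval a0 x).
    - move=> x y _ _ [s As ->] [t At ->].
      have [/asboolP st|/asboolP ts] := tA s t As At.
        exists (sval t (x + y)); first by exists t.
        by apply: le_trans ((svalP t).1.1 x y) _; rewrite lerD2r.
      exists (sval s (x + y)); first by exists s.
      by apply: le_trans ((svalP s).1.1 x y) _; rewrite lerD2l.
    - move=> c x _ c0 [s As ->]; exists (sval s (c *: x)); first by exists s.
      by rewrite (svalP s).1.2 // ltW.
    - by move=> _ [s As ->]; rewrite (sublinear0 (svalP s).1).
    - by exists (sval a0 0); [exists a0 | rewrite (sublinear0 (svalP a0).1)].
  have Gp x : inf (G x) <= p x.
    by apply: (@le_trans _ _ (sval a0 x)); [apply: ge_inf | exact: (svalP a0).2].
  exists (exist _ (fun x => inf (G x)) (conj sG Gp)) => s As.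
  by apply/asboolP => x /=; apply: ge_inf => //; exists s.
have qadd : forall x y, q (x + y) = q x + q y.
  apply: sublinear_minimal_additive => // q' sq' q'q.
  have q'p x : q' x <= p x by apply: le_trans (q'q x) (qp x).
  have := qmin (exist _ q' (conj sq' q'p)).
  by move=> /(_ (introT (asboolP _) q'q))/asboolP.
have qN x : q (- x) = - q x.
  by apply/eqP; rewrite -addr_eq0 -qadd addNr (sublinear0 sq).
exists q; split=> // c x; have [c0|c0] := leP 0 c; first exact: sq.2.
by rewrite -[c]opprK scaleNr qN sq.2 ?mulNr // oppr_ge0 ltW.
Qed.

End SublinearInf.

Section Separation.
Context {R : realType} {X : normedModType R}.

(* A linear minorant of [x |-> inf_(t >= 0, y in D) (|x + t (y - d)| - t rho)], which is
   at most the norm, and at most [- rho] on [d - D]. *)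
Lemma convex_separation (D : set X) (d : X) (rho : R) :
  (forall x y (a : R), 0 <= a <= 1 -> D x -> D y -> D (a *: x + (1 - a) *: y)) ->
  D !=set0 -> 0 <= rho -> (forall y, D y -> rho <= `|y - d|) ->
  exists2 phi : X -> R^o, in_dual phi & forall y, D y -> phi d + rho <= phi y.
Proof.
move=> Dcvx [y0 Dy0] rho0 Drho.
pose G x := [set r : R | exists t y, [/\ 0 <= t, D y & r = `|x + t *: (y - d)| - t * rho]].
have Glb x : lbound (G x) (- `|x|).
  move=> _ [t [y [t0 Dy ->]]]; rewrite lerBrDr addrC lerBlDl.
  apply: (@le_trans _ _ `|t *: (y - d)|).
    by rewrite normrZ ger0_norm // ler_wpM2l // Drho.
  by rewrite -{1}[t *: _](addKr x) -[X in _ <= X + _]normrN ler_normD.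
have Gn x : G x `|x| by exists 0, y0; rewrite scale0r mul0r addr0 subr0.
have sG : sublinear (fun x => inf (G x)).
  apply: (@sublinear_inf _ _ G (fun x => - `|x|)) => //.
  - by move=> x; exists `|x|.
  - move=> x z _ _ [t [y [t0 Dy ->]]] [s [w [s0 Dw ->]]].
    (* The multiples [t] of [y - d] and [s] of [w - d] merge into the multiple [t + s] of a convex
       combination with weights proportional to [t] and [s]; if [t + s] is 0 there are no weights,
       and both terms vanish. *)
    have [ts0|ts] := eqVneq (t + s) 0.
      have /andP[/eqP -> /eqP ->] : (t == 0) && (s == 0).
        by rewrite -paddr_eq0 // ts0.
      exists `|x + z|; first exact: Gn.
      by rewrite !scale0r !mul0r !addr0 !subr0 ler_normD.
    have ts0 : 0 < t + s by rewrite lt_def ts addr_ge0.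
    pose a := t / (t + s).
    have aE : (t + s) * a = t by rewrite mulrC divfK.
    have aE' : (t + s) * (1 - a) = s by rewrite mulrBr mulr1 aE addrAC subrr add0r.
    exists (`|x + z + (t + s) *: (a *: y + (1 - a) *: w - d)| - (t + s) * rho).
      exists (t + s), (a *: y + (1 - a) *: w); split=> //; first exact: ltW.
      apply: Dcvx => //; rewrite /a divr_ge0 ?(ltW ts0) //=.
      by rewrite ler_pdivrMr // mul1r lerDl.
    have -> : x + z + (t + s) *: (a *: y + (1 - a) *: w - d) =
        (x + t *: (y - d)) + (z + s *: (w - d)).
      rewrite scalerBr scalerDr !scalerA aE aE' scalerDl !scalerBr opprD.
      by rewrite [X in _ + X]addrACA [LHS]addrACA.
    by rewrite mulrDl opprD [in leRHS]addrACA lerD2r ler_normD.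
  - move=> c x _ c0 [t [y [t0 Dy ->]]].
    exists (`|c *: x + (c * t) *: (y - d)| - (c * t) * rho).
      by exists (c * t), y; split=> //; rewrite mulr_ge0 // ltW.
    by rewrite -scalerA -scalerDr normrZ gtr0_norm // mulrBr mulrA.
  - by have := Glb 0; rewrite normr0 oppr0.
  - by exists 0; first by have := Gn 0; rewrite normr0.
have [phi [phiD phiZ phip]] := exists_linear_minorant sG.
have hlb x : has_lbound (G x) by exists (- `|x|); exact: Glb.
have phiN x : phi (- x) = - phi x by rewrite -scaleN1r phiZ mulN1r.
have phi_le x : phi x <= `|x| by apply: le_trans (phip x) _; apply: ge_inf.
have phi_n x : `|phi x| <= `|x|.
  by rewrite ler_norml phi_le andbT lerNl -phiN -normrN phi_le.
exists phi.
  split; first by move=> a x y; rewrite phiD phiZ.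
  move=> x; apply/cvgrPdist_lt => e e0; near=> z.
  rewrite -phiN -phiD; apply: le_lt_trans (phi_n _) _.
  by near: z; apply: cvgr_dist_lt.
move=> y Dy; rewrite -lerBrDl -[_ - _]opprK opprB -phiN -phiD lerNr.
apply: le_trans (phip _) _; apply: ge_inf => //; exists 1, y; split=> //.
by rewrite scale1r mul1r -(opprB y d) addNr normr0 sub0r.
Unshelve. all: by end_near. Qed.

(** The supremum in [dual_norm] has its meaning only for a bounded set; continuity at 0 supplies the
    bound [2 / d] on the unit ball. *)
Lemma dual_norm_ub (phi : X -> R^o) : in_dual phi ->
  forall x, `|x| <= 1 -> `|phi x| <= dual_norm phi.
Proof.
move=> [lin cont].
have phi0 : phi 0 = 0 by have := lin (-1) 0 0; rewrite scaler0 addr0 scaleN1r addNr.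
have phiZ (a : R) x : phi (a *: x) = a * phi x.
  by have := lin a x 0; rewrite !addr0 phi0 addr0.
have /cvgrPdist_lt/(_ 1 ltr01)/nbhs_norm0P[d /= d0 H] := cont 0.
have bd x : `|x| <= 1 -> `|phi x| <= 2 / d.
  move=> x1; have : `|phi ((d / 2) *: x)| < 1.
    rewrite -normrN -[- _]add0r -{1}phi0; apply: H => /=.
    rewrite normrZ gtr0_norm ?divr_gt0 //.
    apply: le_lt_trans (ler_wpM2l _ x1) _; first by rewrite divr_ge0 // ltW.
    by rewrite mulr1 ltr_pdivrMr // ltr_pMr // ltr1n.
  rewrite phiZ normrM gtr0_norm ?divr_gt0 // => /ltW.
  by rewrite -ler_pdivlMl ?divr_gt0 // mulr1 invf_div.
have ballE (x : X) : closed_ball_ Num.norm (0 : X) 1 x = (`|x| <= 1) :> Prop.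
  by rewrite /closed_ball_ /= sub0r normrN.
move=> x x1; apply: ub_le_sup.
  by exists (2 / d) => _ [y + <-]; rewrite ballE; exact: bd.
by exists x => //; rewrite ballE.
Qed.

Lemma dual_norm_ge0 (phi : X -> R^o) : in_dual phi -> 0 <= dual_norm phi.
Proof.
move=> dphi; apply: (le_trans (normr_ge0 (phi 0))).
by apply: dual_norm_ub => //; rewrite normr0.
Qed.

Lemma dual_norm_ge (phi : X -> R^o) : in_dual phi ->
  forall x, `|phi x| <= dual_norm phi * `|x|.
Proof.
move=> dphi x; have [lin _] := dphi.
have phi0 : phi 0 = 0 by have := lin (-1) 0 0; rewrite scaler0 addr0 scaleN1r addNr.
have phiZ (a : R) y : phi (a *: y) = a * phi y.
  by have := lin a y 0; rewrite !addr0 phi0 addr0.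
have [->|x0] := eqVneq x 0; first by rewrite phi0 !normr0 mulr0.
have nx : 0 < `|x| by rewrite normr_gt0.
have : `|phi (`|x|^-1 *: x)| <= dual_norm phi.
  apply: dual_norm_ub => //; rewrite normrZ.
  by rewrite normrV ?unitfE ?normr_eq0 // normr_id mulVf // normr_eq0.
rewrite phiZ normrM normrV ?unitfE ?normr_eq0 // normr_id.
by rewrite ler_pdivrMl // mulrC.
Qed.

(** The sublevel sets [Dn n] are nonempty, nested, closed and convex. Limits along an ultrafilter
    [U] containing all of them define [Phi], and the point [d] representing [Phi] turns out to lie
    in every [Dn n], so its norm is the infimum. *)
Lemma reflexive_argmin_norm (D : set X) : reflexive_space X ->
  closed D -> D !=set0 ->
  (forall x y (a : R), 0 <= a <= 1 -> D x -> D y -> D (a *: x + (1 - a) *: y)) ->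
  argmin_norm D !=set0.
Proof.
move=> refl Dcl [y0 Dy0] Dcvx.
pose N := [set `|x| | x in D]; pose m := inf N.
have Nlb : has_lbound N by exists 0 => _ [x _ <-].
have hN : has_inf N by split=> //; exists `|y0|, y0.
pose Dn n := [set x | D x /\ `|x| <= m + n.+1%:R^-1].
have Dn0 n : Dn n !=set0.
  have [|_ [x Dx <-] /ltW xm] := @inf_adherent _ N n.+1%:R^-1 _ hN.
    by rewrite invr_gt0.
  by exists x.
have DnS i j : (i <= j)%N -> Dn j `<=` Dn i.
  move=> ij x [Dx xj]; split=> //; apply: (le_trans xj); rewrite lerD2l.
  by rewrite lef_pV2 ?posrE // ler_nat.
have FF : ProperFilter (filter_from setT Dn).
  apply: filter_from_proper => //; apply: filter_fromT_filter; first by exists 0%N.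
  move=> i j; exists (maxn i j) => x Dx.
  by split; apply: (DnS _ (maxn i j)); rewrite ?leq_maxl ?leq_maxr.
have [U [UU FU]] := ultraFilterLemma FF.
have UDn n : U (Dn n) by apply: FU; exists n.
have m1 : 0 <= m + 1.
  by have [x [_]] := Dn0 0%N; rewrite invr1; exact: le_trans (normr_ge0 x).
(* [phi] is bounded on [Dn 0], so its image ultrafilter clusters in a compact segment; an
   ultrafilter converges to its cluster points. *)
have phi_cvg (phi : X -> R^o) : in_dual phi -> cvg (phi @ U).
  move=> dphi; pose c := dual_norm phi * (m + 1).
  have Uc : (phi @ U) `[- c, c]%classic.
    apply: (@filterS _ U _ (Dn 0%N)) => [x [_ xm] /=|]; last exact: UDn.
    rewrite in_itv /= -ler_norml.
    apply: le_trans (dual_norm_ge dphi x) _.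
    by rewrite ler_wpM2l ?dual_norm_ge0 //; rewrite invr1 in xm.
  have [l [_ cl]] := @segment_compact R (- c) c (phi @ U) _ Uc.
  apply/cvg_ex; exists l => B lB.
  have [//|UB] := in_ultra_setVsetC (phi @^-1` B) UU.
  have [x [nBx Bx]] : ~` B `&` B !=set0 by apply: cl.
  by [].
pose Phi (phi : X -> R) : R := lim ((phi : X -> R^o) @ U).
have bPhi : in_bidual Phi.
  split.
    move=> a phi psi dphi dpsi; apply: cvg_lim => //.
    apply: cvgD; last exact: phi_cvg.
    by apply: cvgMr; exact: phi_cvg.
  exists (m + 1) => phi dphi.
  have cn : (fun x => `|phi x|) @ U --> `|Phi phi|.
    by apply: cvg_norm; exact: phi_cvg.
  rewrite -(cvg_lim _ cn) //; apply: limr_le; first exact: cvgP cn.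
  apply: (@filterS _ U _ (Dn 0%N)) => [x [_]|]; last exact: UDn.
  rewrite invr1 => xm.
  by apply: le_trans (dual_norm_ge dphi x) _; rewrite mulrC ler_wpM2r // dual_norm_ge0.
have [d dE] := refl Phi bPhi.
(* Otherwise a ball around [d] misses [Dn n], and a separating [phi] is at least [phi d + rho] on
   [Dn n], hence also in the limit along [U]; but that limit is [phi d]. *)
have Dd n : Dn n d.
  have Dncl : closed (Dn n).
    have -> : Dn n = D `&` (fun x : X => `|x|) @^-1` [set r : R | r <= m + n.+1%:R^-1] by [].
    apply: closedI => //.
    by apply: closed_comp; [move=> x _; exact: norm_continuous | exact: closed_le].
  apply: contrapT => nDd.
  have : nbhs d (~` Dn n) by apply: open_nbhs_nbhs; split=> //; exact: closed_openC.
  move=> /nbhs_ballP[rho /= rho0]; rewrite -ball_normE /= => Hrho.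
  have [||||phi dphi Hphi] := @convex_separation (Dn n) d rho.
  - move=> x y a /[dup] a01 /andP[a0 a1] [Dx xm] [Dy ym]; split; first exact: Dcvx.
    apply: le_trans (ler_normD _ _) _; rewrite !normrZ ger0_norm //.
    rewrite ger0_norm ?subr_ge0 //.
    have h1 := ler_wpM2l a0 xm.
    have h2 : (1 - a) * `|y| <= (1 - a) * (m + n.+1%:R^-1).
      by rewrite ler_wpM2l // subr_ge0.
    by apply: le_trans (lerD h1 h2) _; rewrite -mulrDl addrC subrK mul1r.
  - exact: Dn0.
  - exact: ltW.
  - move=> y Dy; rewrite leNgt; apply/negP => yd.
    by apply: (Hrho y) => //=; rewrite distrC.
  have := dE phi dphi; apply/eqP; rewrite gt_eqF //.
  apply: (@lt_le_trans _ _ (phi d + rho)); first by rewrite ltrDl.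
  apply: limr_ge; first exact: phi_cvg.
  exact: (@filterS _ U _ (Dn n)).
exists d; split; first exact: (Dd 0%N).1.
move=> d' Dd'; apply: (@le_trans _ _ m); last by apply: ge_inf => //; exists d'.
apply/ler_addgt0Pr => e e0.
have me : m < m + e by rewrite ltrDl.
have [n ne] := ltr_add_invr me.
exact: le_trans (Dd n).2 (ltW ne).
Qed.
End Separation.

(** * Convex processes *)

Lemma series_geometric_bound (R : realType) (V : completeNormedModType R)
    (u : nat -> V) (c q : R) : 0 <= q < 1 -> (forall n, `|u n| <= c * q ^+ n) ->
  exists D : V, series u @ \oo --> D /\ `|D| <= c / (1 - q).
Proof.
move=> /andP[q0 q1] uq.
have q1' : `|q| < 1 by rewrite ger0_norm.
have cg := @is_cvg_geometric_series R c q q1'.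
have cu : cvgn [normed series u].
  by apply: (series_le_cvg _ _ uq cg) => n //; exact: le_trans (normr_ge0 _) (uq n).
exists (limn (series u)); split; first exact: normed_cvg.
apply: le_trans (lim_series_norm cu) _.
rewrite -(cvg_lim _ (@cvg_geometric_series R c q q1')) //.
exact: lim_series_le.
Qed.

Section ConvexProcess.
Context {R : realType} {X Y : completeNormedModType R}.
Variables (A : {linear X -> Y}) (C : set Y).
Hypothesis A_cont : continuous A.
Hypothesis C0 : C 0.
Hypothesis C_add : forall x y, C x -> C y -> C (x + y).
Hypothesis C_scale : forall (a : R) y, 0 <= a -> C y -> C (a *: y).
Hypothesis C_closed : closed C.
Hypothesis A_onto : forall y, exists d, C (A d - y).

(** The norm of the inverse of the process T d = A d - C at [y], as a real number: [A_onto] keeps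
    the set nonempty, so the infimum is a genuine one. *)
Definition proc_norm (y : Y) : R := inf [set `|d| | d in [set d | C (A d - y)]].

Let has_lb y : has_lbound [set `|d| | d in [set d | C (A d - y)]].
Proof. by exists 0 => _ [d _ <-]. Qed.

Let nonempty y : [set `|d| | d in [set d | C (A d - y)]] !=set0.
Proof. by have [d Cd] := A_onto y; exists `|d|, d. Qed.

Lemma proc_norm_le y d : C (A d - y) -> proc_norm y <= `|d|.
Proof. by move=> Cd; apply: ge_inf => //; exists d. Qed.

Lemma proc_norm_ge0 y : 0 <= proc_norm y.
Proof. by apply: lb_le_inf => // _ [d _ <-]. Qed.

Lemma proc_norm_lt y r : proc_norm y < r -> exists2 d, C (A d - y) & `|d| < r.
Proof.
move=> pr; have e0 : 0 < r - proc_norm y by rewrite subr_gt0.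
have [|_ [d Cd <-]] := @inf_adherent _ [set `|d| | d in [set d | C (A d - y)]] _ e0.
  by split.
by rewrite -/(proc_norm y) addrC subrK => dr; exists d.
Qed.

Lemma proc_norm_sublinear : sublinear proc_norm.
Proof.
apply: (@sublinear_inf _ _ (fun y => [set `|d| | d in [set d | C (A d - y)]]) (fun=> 0)) => //.
- by move=> y _ [d _ <-].
- move=> x y _ _ [d Cd <-] [e Ce <-]; exists `|d + e|; last exact: ler_normD.
  exists (d + e) => //=; rewrite linearD opprD addrACA; exact: C_add.
- move=> c x _ c0 [d Cd <-]; exists `|c *: d|; last by rewrite normrZ gtr0_norm.
  exists (c *: d) => //=; rewrite linearZ -scalerBr; apply: C_scale => //; exact: ltW.
- by move=> _ [d _ <-].
- by exists 0 => //; exists 0; rewrite /= ?normr0 // linear0 subr0.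
Qed.

Lemma proc_series (d : nat -> X) (y : nat -> Y) (D : X) (ys : Y) :
  (forall n, C (A (d n) - y n)) -> series d @ \oo --> D ->
  series y @ \oo --> ys -> C (A D - ys).
Proof.
move=> Cd dD yys.
apply: (@closed_cvg _ _ \oo _ (fun n => A (series d n) - series y n) C) => //.
  apply: nearW => n; elim: n => [|n IH].
    by rewrite /series /= !big_geq // linear0 subr0.
  rewrite !seriesSr linearD opprD addrACA; exact: C_add.
apply: cvgB => //; exact: (@continuous_cvg _ _ _ \oo _ (series d) A D (@A_cont D) dD).
Qed.

(* Zabreiko's argument: a countably subadditive functional on a Banach space is
   bounded on a ball. *)
Lemma proc_norm_bounded : exists2 P : R, 0 <= P & forall y, proc_norm y <= P * `|y|.
Proof.
pose K (n : nat) := [set y | proc_norm y <= n%:R].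
have [n nd] : exists n, ~ dense (~` closure (K n)).
  apply: contrapT => /forallNP H.
  have /(_ setT) [] : dense (\bigcap_i (~` closure (K i))).
    apply: Baire => i; split; last exact: contrapT (H i).
    by apply: closed_openC; exact: closed_closure.
  - by exists 0.
  - exact: openT.
  move=> y [_ /(_ (Num.bound (proc_norm y)) I)]; apply; apply: subset_closure.
  by rewrite /K /= ltW // archi_boundP // proc_norm_ge0.
have [V [V0 Vo VK]] : exists V : set Y, [/\ V !=set0, open V & V `<=` closure (K n)].
  apply: contrapT => H; apply: nd => V V0 Vo.
  apply: contrapT => H'; apply: H; exists V; split=> // y Oy.
  by apply: contrapT => ny; apply: H'; exists y.
have [c Vc] := V0.
have /nbhs_ballP[r /= r0 Hr] : nbhs c V by apply: open_nbhs_nbhs.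
pose N := n%:R + proc_norm (- c).
have N0 : 0 <= N by rewrite addr_ge0 // proc_norm_ge0.
have dens z e : `|z| < r -> 0 < e -> exists2 w, proc_norm w <= N & `|z - w| < e.
  move=> zr e0.
  have /VK/(_ (ball (c + z) e)) : V (c + z).
    by apply: Hr; rewrite -ball_normE /= opprD addrA subrr sub0r normrN.
  case; first exact: nbhsx_ballx.
  move=> w' [Kw']; rewrite -ball_normE /= => wz; exists (w' - c).
    by apply: le_trans (proc_norm_sublinear.1 _ _) _; rewrite lerD2r.
  by rewrite opprB addrA [z + c]addrC.
(* One correction: an error below [r * s] is halved by a right-hand side [w] with a solution of norm
   at most [(N + 1) * s]. The premises sit inside the existential so that a total choice function
   can be extracted; [(0, 0)] is the filler value. *)
have step (s : R) z : exists wd : Y * X, 0 < s -> `|z| < r * s ->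
    [/\ C (A wd.2 - wd.1), `|wd.2| <= (N + 1) * s & `|z - wd.1| < r * (s / 2)].
  have [s0|s0] := ltP 0 s; last by exists (0, 0).
  have [zr|zr] := ltP `|z| (r * s); last by exists (0, 0).
  have sn : s != 0 by rewrite gt_eqF.
  have [||w wN zw] := @dens (s^-1 *: z) (r / 2).
  - by rewrite normrZ normfV gtr0_norm // mulrC ltr_pdivrMr.
  - by rewrite divr_gt0.
  have [|d Cd dN] := @proc_norm_lt w (N + 1).
    by rewrite (le_lt_trans wN) // ltrDl.
  exists (s *: w, s *: d) => _ _ /=; split.
  - by rewrite linearZ -scalerBr; apply: C_scale => //; exact: ltW.
  - by rewrite normrZ gtr0_norm // mulrC ler_pM2r // ltW.
  - rewrite -[z](scalerKV sn) -scalerBr normrZ gtr0_norm //.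
    by rewrite mulrCA ltr_pM2l.
pose wd s z := projT1 (cid (step s z)).
have wdP s z : 0 < s -> `|z| < r * s -> [/\ C (A (wd s z).2 - (wd s z).1),
    `|(wd s z).2| <= (N + 1) * s & `|z - (wd s z).1| < r * (s / 2)].
  exact: projT2 (cid (step s z)).
have small z : `|z| < r -> proc_norm z <= 2 * (N + 1).
  move=> zr; pose zs := fix zs k := if k is k'.+1 then
    zs k' - (wd (2^-1 ^+ k') (zs k')).1 else z.
  have h0 k : 0 < 2^-1 ^+ k :> R by rewrite exprn_gt0 // invr_gt0.
  have zsr k : `|zs k| < r * 2^-1 ^+ k.
    elim: k => [|k IH]; first by rewrite expr0 mulr1.
    by have [_ _] := wdP _ _ (h0 k) IH; rewrite exprSr.
  pose d k := (wd (2^-1 ^+ k) (zs k)).2; pose w k := (wd (2^-1 ^+ k) (zs k)).1.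
  have Cd k : C (A (d k) - w k) by have [] := wdP _ _ (h0 k) (zsr k).
  have [||D [dD Dn]] := @series_geometric_bound R X d (N + 1) 2^-1.
  - by rewrite invr_ge0 ler0n /= invf_lt1 // ltr1n.
  - by move=> k; have [] := wdP _ _ (h0 k) (zsr k).
  have sw k : series w k = z - zs k.
    elim: k => [|k IH]; first by rewrite /series /= big_geq // subrr.
    by rewrite seriesSr IH /= opprB addrAC addrA.
  have ws : series w @ \oo --> z.
    have -> : series w = fun k => z - zs k by apply/funext.
    rewrite -[X in _ --> X](subr0 z); apply: cvgB; first exact: cvg_cst.
    apply/norm_cvg0P; apply: (@squeeze_cvgr _ _ _ _ (cst 0) (fun k => r * 2^-1 ^+ k)).
    - by near=> k; rewrite normr_ge0 /= ltW.
    - exact: cvg_cst.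
    - rewrite -[X in _ --> X](mulr0 r); apply: cvgMr; apply: cvg_expr.
      by rewrite ger0_norm ?invr_ge0 ?ler0n // invf_lt1 // ltr1n.
  apply: le_trans (proc_norm_le (proc_series Cd dD ws)) _.
  apply: le_trans Dn _; have -> : 1 - 2^-1 = 2^-1 :> R by lra.
  by rewrite invrK mulrC.
have P0 : 0 <= 4 * (N + 1) / r by rewrite divr_ge0 ?(ltW r0) // mulr_ge0 // addr_ge0.
exists (4 * (N + 1) / r) => // y.
have [->|y0] := eqVneq y 0.
  by rewrite (sublinear0 proc_norm_sublinear) normr0 mulr0.
have ny : 0 < `|y| by rewrite normr_gt0.
pose a := r / (2 * `|y|).
have a0 : 0 < a by rewrite divr_gt0 // mulr_gt0.
have : proc_norm (a *: y) <= 2 * (N + 1).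
  apply: small; rewrite normrZ gtr0_norm // /a invfM mulrA mulfVK ?gt_eqF //.
  by rewrite ltr_pdivrMr // ltr_pMr // ltr1n.
rewrite (proc_norm_sublinear.2 a y (ltW a0)) -ler_pdivlMl // => /le_trans; apply.
rewrite le_eqVlt; apply/orP; left; apply/eqP; rewrite /a; field.
by rewrite !gt_eqF.
Unshelve. all: by end_near. Qed.

(* [A D - y] is solved up to an error [(A - Ax) D], which becomes the next right-hand
   side. *)
Lemma proc_perturbation (Ax : {linear X -> Y}) (theta K : R) y :
  continuous Ax -> 0 <= theta ->
  (forall v, proc_norm (A v - Ax v) <= theta * `|v|) ->
  proc_norm y < K * (1 - theta) -> theta < 1 ->
  exists2 D, C (Ax D - y) & `|D| <= K.
Proof.
move=> Axc th0 Hth yK th1.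
have K0 : 0 < K.
  by rewrite -(pmulr_lgt0 K (_ : 0 < 1 - theta)) ?subr_gt0 // (le_lt_trans _ yK) ?proc_norm_ge0.
(* The midpoint between [theta] and [1 - proc_norm y / K]. Room on both sides is needed because the
   infimum defining [proc_norm] need not be attained. *)
pose q := theta + (K * (1 - theta) - proc_norm y) / (2 * K).
have thq : theta < q by rewrite ltrDl divr_gt0 ?subr_gt0 // mulr_gt0.
have yKq : proc_norm y < K * (1 - q).
  have -> : K * (1 - q) = (K * (1 - theta) + proc_norm y) / 2.
    by rewrite /q; field; rewrite gt_eqF.
  by rewrite ltr_pdivlMr //; lra.
have q1 : q < 1.
  rewrite -subr_gt0 -(pmulr_rgt0 _ K0); exact: le_lt_trans (proc_norm_ge0 _) yKq.
have q0 : 0 <= q by rewrite ltW // (le_lt_trans th0).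
have [d0 Cd0 d0K] := proc_norm_lt yKq.
have step v : exists d, C (A d - (A v - Ax v)) /\ `|d| <= q * `|v|.
  have [->|v0] := eqVneq v 0.
    by exists 0; rewrite (linear0 A) (linear0 Ax) !subr0 normr0 mulr0.
  have [|d Cd dq] := @proc_norm_lt (A v - Ax v) (q * `|v|).
    by apply: le_lt_trans (Hth v) _; rewrite ltr_pM2r // normr_gt0.
  by exists d; split=> //; exact: ltW.
have [S HS] := choice step.
pose d n := iter n S d0.
have [||D [dD Dn]] := @series_geometric_bound R X d `|d0| q.
- by rewrite q0.
- elim=> [|n IH]; first by rewrite expr0 mulr1.
  by apply: le_trans (HS _).2 _; rewrite exprS mulrCA ler_wpM2l.
exists D; last first.
  apply: le_trans Dn _; rewrite ler_pdivrMr ?subr_gt0 //; exact: ltW.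
(* The successive right-hand sides. Their sum is [y + (A D - Ax D)], so the limiting inclusion for
   [A] becomes the wanted one for [Ax]. *)
pose w n := if n is n'.+1 then A (d n') - Ax (d n') else y.
have Cd n : C (A (d n) - w n) by case: n => [|n] //=; exact: (HS (d n)).1.
have sw n : series w n.+1 = y + (A (series d n) - Ax (series d n)).
  elim: n => [|n IH].
    by rewrite seriesSr /series /= !big_geq // (linear0 A) (linear0 Ax) subr0 addr0 add0r.
  rewrite seriesSr IH /= [series d n.+1]seriesSr (linearD A) (linearD Ax) opprD.
    by rewrite [in RHS]addrACA [RHS]addrA.
have ws : series w @ \oo --> y + (A D - Ax D).
  rewrite -cvg_shiftS.
  have -> : [sequence series w n.+1]_n =
    fun n => y + (A (series d n) - Ax (series d n)) by apply/funext => n; exact: sw.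
  apply: cvgD; first exact: cvg_cst.
  by apply: cvgB; [exact: (@continuous_cvg _ _ _ \oo _ (series d) A D (@A_cont D) dD)
                 | exact: (@continuous_cvg _ _ _ \oo _ (series d) Ax D (Axc D) dD)].
have := proc_series Cd dD ws.
by rewrite opprD opprB addrCA [A D + _]addrC subrK addrC.
Qed.

End ConvexProcess.

(** * Derivatives of power series *)

Section SymmetricForms.
Context {R : realType} {X Y : normedModType R}.

(* A symmetric [j]-linear map given on sequences of length [j]; the homogeneous
   polynomial it defines is [h |-> b (nseq j h)]. *)
Definition symform (j : nat) (B : R) (b : seq X -> Y) : Prop :=
  [/\ forall s t, size s = j -> perm_eq s t -> b s = b t,
      forall (c : R) u w s, (size s).+1 = j ->
        b (c *: u + w :: s) = c *: b (u :: s) + b (w :: s) &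
      forall s, size s = j -> `|b s| <= B * \prod_(z <- s) `|z| ].

(** The coefficients in [analytic_at] are not assumed symmetric; averaging over permutations
    preserves their diagonal values and their bounds. On sequences of length [j] the default of
    [nth] is never read. *)
Definition symmetrize j (a : ('I_j -> X) -> Y) (s : seq X) : Y :=
  (j`!%:R)^-1 *: \sum_(sg : 'S_j) a (fun i => nth 0 s (sg i)).

Lemma symmetrize_diag j (a : ('I_j -> X) -> Y) h :
  symmetrize a (nseq j h) = a (fun=> h).
Proof.
rewrite /symmetrize (eq_bigr (fun=> a (fun=> h))); last first.
  by move=> sg _; congr a; apply/funext => i; rewrite nth_nseq ltn_ord.
rewrite sumr_const card_Sn -[X in _ *: X]scaler_nat scalerA mulVf ?scale1r //.
Qed.

Lemma symform_symmetrize j (a : ('I_j -> X) -> Y) B :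
  multilinear a -> multilinear_bound a B -> symform j B (symmetrize a).
Proof.
move=> aml aB; split.
- move=> s t sj st; have tj : size t = j by rewrite -(perm_size st).
  pose ts : j.-tuple X := Tuple (introT eqP sj).
  pose tt : j.-tuple X := Tuple (introT eqP tj).
  have /tuple_permP[p pE] : perm_eq ts tt by [].
  rewrite /symmetrize; congr (_ *: _).
  rewrite [RHS](reindex_inj (mulIg p)) /=; apply: eq_bigr => sg _.
  congr a; apply/funext => i; rewrite permM.
  rewrite -[s]/(tval ts) pE -(tnth_nth 0 _ (sg i)) tnth_mktuple.
  by rewrite (tnth_nth 0).
- move=> c u w s sj; rewrite /symmetrize scalerA mulrC -scalerA -scalerDr.
  congr (_ *: _); rewrite scaler_sumr -big_split; apply: eq_bigr => sg _ /=.
  have j0 : (0 < j)%N by rewrite -sj.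
  (* The one argument slot that receives the head of the sequence under [sg]. *)
  pose i0 := (sg^-1)%g (Ordinal j0).
  have E z : (fun i => nth 0 (z :: s) (sg i)) =
      (fun i => if i == i0 then z else nth 0 (0 :: s) (sg i)).
    apply/funext => i; case: eqVneq => [->|ni]; first by rewrite /i0 permKV.
    case sgi : (val (sg i)) => [|k] //=.
    case/eqP: ni; apply: (@perm_inj _ sg); rewrite permKV; exact: val_inj.
  by rewrite !E aml.
- move=> s sj; rewrite normrZ normfV gtr0_norm ?ltr0n ?fact_gt0 //.
  rewrite ler_pdivrMl ?ltr0n ?fact_gt0 //.
  apply: le_trans (ler_norm_sum _ _ _) _.
  apply: (@le_trans _ _ (\sum_(sg : 'S_j) B * \prod_(z <- s) `|z|)).
    apply: ler_sum => sg _; apply: le_trans (aB _) _.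
    rewrite le_eqVlt; apply/orP; left; apply/eqP; congr (_ * _).
    rewrite -[s in RHS](mkseq_nth 0) big_map sj.
    have -> : iota 0 j = [seq val i | i <- enum 'I_j] by rewrite val_enum_ord.
    rewrite big_map big_enum /=.
    by rewrite [RHS](reindex_inj (@perm_inj _ sg)).
  by rewrite sumr_const card_Sn mulr_natl.
Qed.

Section Estimates.
Variables (j : nat) (B : R) (b : seq X -> Y).
Hypothesis bsym : symform j B b.

Lemma symform_add u w s : (size s).+1 = j ->
  b (u + w :: s) = b (u :: s) + b (w :: s).
Proof. by move=> sj; have [_ /(_ 1 u w s sj)] := bsym; rewrite !scale1r. Qed.

Lemma symform_bound (v : seq X) (m : nat) (h : X) : (size v + m)%N = j ->
  `|b (v ++ nseq m h)| <= B * \prod_(z <- v) `|z| * `|h| ^+ m.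
Proof.
move=> vm; have [_ _ /(_ (v ++ nseq m h))] := bsym.
rewrite size_cat size_nseq => /(_ vm); rewrite big_cat /= mulrA.
by rewrite big_nseq iter_mulr_1.
Qed.

(** Induction on [m], moving one entry [h + u] into the prefix [v]. The error grows from the
    inductive [E] by [m] copies of [b (u :: u :: w)], matching 'C(m, 2) + m = 'C(m.+1, 2). The
    truncated [m.-1] and [m - 2] occur only with coefficient 0. *)
Lemma symform_taylor2 (rho : R) (h u : X) : 0 <= B ->
  `|h| <= rho -> `|h + u| <= rho ->
  forall m (v : seq X), (size v + m)%N = j ->
  `|b (v ++ nseq m (h + u)) - b (v ++ nseq m h)
    - m%:R *: b (u :: v ++ nseq m.-1 h)|
  <= 'C(m, 2)%:R * (B * \prod_(z <- v) `|z|) * `|u| ^+ 2 * rho ^+ (m - 2).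
Proof.
move=> B0 hr hur; have rho0 : 0 <= rho by apply: le_trans hr.
have [bperm _ _] := bsym.
elim=> [|m IH] v vm.
  by rewrite /= subrr scale0r subrr normr0 !mul0r.
have Pv0 : 0 <= \prod_(z <- v) `|z| by apply: prodr_ge0.
have shift z t : b (v ++ z :: nseq m t) = b (z :: v ++ nseq m t).
  apply: bperm; first by rewrite size_cat /= size_nseq.
  by rewrite -(cat1s z (nseq m t)) perm_catCA.
rewrite /= !shift.
have sz t : (size (v ++ nseq m t)).+1 = j by rewrite size_cat size_nseq -addnS.
have := IH (h + u :: v) _; rewrite /= addSnnS => /(_ vm).
set E := (X in `|X|) => HE.
have [m0|m0] := posnP m.
  subst m; rewrite symform_add // [X in X - _]addrAC subrr add0r scale1r subrr normr0.
  by rewrite !mul0r.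
pose w := v ++ nseq m.-1 h.
have szw : (size w).+2 = j by rewrite /w size_cat size_nseq -!addnS prednK.
pose D := b (u :: u :: w).
have bh : b (u :: v ++ nseq m h) = b (h :: u :: w).
  rewrite -{1}(prednK m0) /=; apply: bperm.
    by rewrite /= size_cat /= size_nseq -addnS prednK.
  by rewrite -cat_cons -(cat1s h (nseq _ _)) perm_catCA.
have bD : b (u :: h + u :: w) - b (u :: v ++ nseq m h) = D.
  have -> : b (u :: h + u :: w) = b (h + u :: u :: w).
    by apply: bperm; rewrite // -(cat1s u (_ :: _)) -(cat1s (h + u) w) perm_catCA.
  by rewrite bh symform_add //= addrAC subrr add0r.
have -> : b (h + u :: v ++ nseq m (h + u)) - b (h :: v ++ nseq m h)
    - m.+1%:R *: b (u :: v ++ nseq m h) = E + m%:R *: D.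
  rewrite -bD scalerBr /E addrA subrK [b (h + u :: v ++ nseq m h)]symform_add //.
  by rewrite -natr1 scalerDl scale1r !opprD !addrA [LHS]addrAC.
have HD : `|m%:R *: D| <= m%:R * (B * \prod_(z <- v) `|z|) * `|u| ^+ 2 * rho ^+ m.-1.
  rewrite normrZ ger0_norm ?ler0n // -!mulrA ler_wpM2l ?ler0n //.
  apply: le_trans (@symform_bound (u :: u :: v) m.-1 h _) _.
    by rewrite /= addSnnS prednK // addSnnS.
  rewrite !big_cons.
  have -> : B * (`|u| * (`|u| * \prod_(z <- v) `|z|)) * `|h| ^+ m.-1 =
    (B * (\prod_(z <- v) `|z| * `|u| ^+ 2)) * `|h| ^+ m.-1 by ring.
  rewrite !mulrA ler_wpM2l //; first by rewrite !mulr_ge0 // exprn_ge0.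
  by rewrite lerXn2r // nnegrE.
apply: le_trans (ler_normD _ _) _; apply: le_trans (lerD HE HD) _.
rewrite big_cons binS bin1 natrD -[in leRHS](prednK m0) subSS subn1 /= prednK //.
rewrite !mulrDl lerD2r.
have [m1|m1] := leqP m 1.
  have -> : m = 1%N by apply/eqP; rewrite eqn_leq m1.
  by rewrite !mul0r.
have -> : m.-1 = (m - 2).+1 by rewrite subn2 prednK // -ltnS prednK.
rewrite (exprS rho).
have -> : 'C(m, 2)%:R * (B * (`|h + u| * \prod_(z <- v) `|z|)) * `|u| ^+ 2 * rho ^+ (m - 2)
  = 'C(m, 2)%:R * (B * \prod_(z <- v) `|z|) * `|u| ^+ 2 * (`|h + u| * rho ^+ (m - 2)) by ring.
rewrite ler_wpM2l //; last by rewrite ler_wpM2r // exprn_ge0.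
by rewrite !mulr_ge0 // exprn_ge0.
Qed.

End Estimates.

Lemma codom_vcons k (u : X) (v : 'I_k -> X) : codom (vcons u v) = u :: codom v.
Proof.
rewrite /codom /image_mem enum_ordSl /= /vcons unlift_none; congr (_ :: _).
by rewrite -map_comp; apply: eq_map => i /=; rewrite liftK.
Qed.

Lemma prod_codom k (v : 'I_k -> X) : \prod_(z <- codom v) `|z| = \prod_(i < k) `|v i|.
Proof. by rewrite big_map big_enum. Qed.

Lemma symform_multilinear j B b k m h : symform j B b -> (k + m)%N = j ->
  multilinear (fun v : 'I_k -> X => b (codom v ++ nseq m h)).
Proof.
move=> bsym km i v; have [bperm blin _] := bsym.
have ein : i \in enum 'I_k by rewrite mem_enum.
pose s := [seq v l | l <- rem i (enum 'I_k)] ++ nseq m h.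
have ss : (size s).+1 = j.
  by rewrite /s size_cat size_map size_rem // size_enum_ord size_nseq -addSn prednK // (leq_ltn_trans _ (ltn_ord i)).
have E u : b (codom (fun l => if l == i then u else v l) ++ nseq m h) = b (u :: s).
  apply: bperm; first by rewrite size_cat size_codom card_ord size_nseq.
  rewrite /s -cat_cons perm_cat2r.
  apply: perm_trans (perm_map _ (perm_to_rem ein)) _ => /=; rewrite eqxx.
  have -> // : map (fun l => if l == i then u else v l) (rem i (enum 'I_k)) =
      map v (rem i (enum 'I_k)).
  by apply/eq_in_map => l; rewrite mem_rem_uniq ?enum_uniq // inE => /andP[/negbTE ->].
by move=> c u w; rewrite !E blin.
Qed.

Lemma vcons_eta k (w : 'I_k.+1 -> X) : w = vcons (w ord0) (fun i => w (lift ord0 i)).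
Proof.
by apply/funext => i; rewrite /vcons; case: unliftP => [l ->|->].
Qed.

Lemma multilinear_vconsE k (A : ('I_k.+1 -> X) -> Y) v :
  multilinear A -> linear (fun u => A (vcons u v)).
Proof.
move=> Aml; have E u : vcons u v = fun l => if l == ord0 then u else vcons 0 v l.
  apply/funext => l; rewrite /vcons; case: unliftP => [l' ->|->].
    by rewrite eq_sym (negbTE (neq_lift _ _)).
  by rewrite eqxx.
by move=> c u w; rewrite (E (_ + _)) (E u) (E w) Aml.
Qed.

(** The difference of two candidates is linear in [h] and o(|h|); scaling [h] by a small [c] and
    cancelling [c] makes it 0. This pins down the value that [xget] returns in [nderive]. *)
Lemma mderive_unique k (G : X -> ('I_k -> X) -> Y) x A A' :
  is_mderive G x A -> is_mderive G x A' -> A = A'.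
Proof.
move=> [Aml _ HA] [A'ml _ HA']; apply/funext => w; rewrite (vcons_eta w).
move: (w ord0) (fun i => w (lift ord0 i)) => h v.
apply/eqP; rewrite -subr_eq0 -normr_le0; apply/ler_addgt0Pr => e e0; rewrite add0r.
pose Pv := \prod_(i < k) `|v i|.
have Pv0 : 0 <= Pv by apply: prodr_ge0.
pose e1 := e / (2 * (`|h| + 1) * (Pv + 1)).
have h10 : 0 < `|h| + 1 by rewrite ltr_wpDl.
have P10 : 0 < Pv + 1 by rewrite ltr_wpDl.
have e10 : 0 < e1 by rewrite divr_gt0 // !mulr_gt0.
have /nbhs_norm0P[d /= d0 H] : \forall u \near (0 : X),
    `|A (vcons u v) - A' (vcons u v)| <= 2 * e1 * `|u| * Pv.
  near=> u.
  have H1 : multilinear_bound (fun v => G (x + u) v - G x v - A (vcons u v)) (e1 * `|u|).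
    by near: u; exact: HA.
  have H2 : multilinear_bound (fun v => G (x + u) v - G x v - A' (vcons u v)) (e1 * `|u|).
    by near: u; exact: HA'.
  have split_sub (g q q' : Y) : q - q' = (g - q') - (g - q).
    by rewrite opprB [RHS]addrC addrA subrK.
  rewrite (split_sub (G (x + u) v - G x v)).
  apply: le_trans (ler_normB _ _) _; apply: le_trans (lerD (H2 v) (H1 v)) _.
  by rewrite -/Pv le_eqVlt; apply/orP; left; apply/eqP; ring.
have AZ (B : ('I_k.+1 -> X) -> Y) (c : R) : multilinear B ->
    B (vcons (c *: h) v) = c *: B (vcons h v).
  move=> Bml; have := @multilinear_vconsE _ B v Bml; move=> lin.
  have B0 : B (vcons 0 v) = 0.
    by have := lin (-1) 0 0; rewrite scaler0 addr0 scaleN1r addNr.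
  by have := lin c h 0; rewrite addr0 B0 addr0.
have [c c0 cd] : exists2 c : R, 0 < c & `|c *: h| < d.
  have c0 : 0 < d / (2 * (`|h| + 1)) by rewrite divr_gt0 // mulr_gt0.
  exists (d / (2 * (`|h| + 1))) => //.
  rewrite normrZ gtr0_norm // mulrAC ltr_pdivrMr ?mulr_gt0 // ltr_pM2l //.
  by have := normr_ge0 h; lra.
have := H _ cd; rewrite /= !AZ // -scalerBr !normrZ (gtr0_norm c0).
have -> : 2 * e1 * (c * `|h|) * Pv = c * (2 * e1 * `|h| * Pv) by ring.
rewrite ler_pM2l // => /le_trans; apply.
rewrite /e1.
have -> : 2 * (e / (2 * (`|h| + 1) * (Pv + 1))) * `|h| * Pv =
   e * ((`|h| / (`|h| + 1)) * (Pv / (Pv + 1))).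
  by field; rewrite !gt_eqF.
rewrite ler_piMr ?(ltW e0) // mulr_ile1 ?divr_ge0 ?(ltW h10) ?(ltW P10) //.
  by rewrite ler_pdivrMr // mul1r lerDl.
by rewrite ler_pdivrMr // mul1r lerDl.
Unshelve. all: by end_near. Qed.

End SymmetricForms.

(** * Termwise differentiation of power series *)

Section PowerSeries.
Context {R : realType} {X : normedModType R} {Y : completeNormedModType R}.
Variables (r M : R) (b : nat -> seq X -> Y).
Hypothesis r_gt0 : 0 < r.
Hypothesis M_ge0 : 0 <= M.
Hypothesis bsym : forall j, symform j (M / r ^+ j) (b j).

(** The degree [j] part of the [k]-th derivative: the falling factorial counts the ordered choices
    of the slots receiving [v], and it vanishes for [j < k], where [j - k] is truncated. *)
Definition pder_term k (h : X) (v : 'I_k -> X) (j : nat) : Y :=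
  (j ^_ k)%:R *: b j (codom v ++ nseq (j - k) h).

Definition pder k (h : X) (v : 'I_k -> X) : Y := limn (series (pder_term h v)).

(** The falling factorial is at most [k! 2 ^ j]. On the ball of radius [r / 4] the powers contribute
    [4 ^- j], so a factor [2 ^- j] remains; hence the choice of that radius. *)
Lemma pder_coef_bound k j :
  (j ^_ k)%:R * (M / r ^+ j) * (r / 4) ^+ (j - k)
  <= M * k`!%:R * (4 / r) ^+ k * 2^-1 ^+ j.
Proof.
have [jk|kj] := ltnP j k.
  by rewrite ffact_small // !mul0r !mulr_ge0 // exprn_ge0 // ?divr_ge0 // ?(ltW r_gt0) // invr_ge0.
have c0 : 0 <= M / r ^+ j * (r / 4) ^+ (j - k).
  by rewrite mulr_ge0 // ?divr_ge0 // exprn_ge0 // ?divr_ge0 // ltW.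
have bn : (j ^_ k)%:R <= k`!%:R * 2 ^+ j :> R.
  by rewrite -natrX -natrM ler_nat -bin_ffact mulnC leq_mul2l leq_bin_exp2 orbT.
rewrite -mulrA; apply: le_trans (ler_wpM2r c0 bn) _.
rewrite le_eqVlt; apply/orP; left; apply/eqP.
rewrite -{1 2 4}(subnK kj) !exprD !expr_div_n !exprVn.
have -> : 4 = 2 * 2 :> R by ring.
rewrite !exprMn.
have rn n : r ^+ n != 0 by rewrite expf_neq0 // gt_eqF.
have tn n : 2 ^+ n != 0 :> R by rewrite expf_neq0 // pnatr_eq0.
by field; rewrite !rn !tn.
Qed.

Lemma prodn_ge0 k (v : 'I_k -> X) : 0 <= \prod_(i < k) `|v i|.
Proof. exact: prodr_ge0. Qed.
Hint Resolve prodn_ge0 : core.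

Lemma pder_term_bound k h (v : 'I_k -> X) j : `|h| <= r / 4 ->
  `|pder_term h v j| <=
    (M * k`!%:R * (4 / r) ^+ k * \prod_(i < k) `|v i|) * 2^-1 ^+ j.
Proof.
move=> hr; apply: (@le_trans _ _ (\prod_(i < k) `|v i| *
    ((j ^_ k)%:R * (M / r ^+ j) * (r / 4) ^+ (j - k)))); last first.
  by apply: le_trans (ler_wpM2l _ (pder_coef_bound k j)) _ => //; rewrite mulrC mulrAC.
rewrite normrZ ger0_norm ?ler0n //.
have [jk|kj] := ltnP j k; first by rewrite ffact_small // !mul0r mulr0.
have := symform_bound (bsym j) (v := codom v) (m := j - k) h.
rewrite size_codom card_ord subnKC // prod_codom => /(_ erefl) H.
have -> : \prod_(i < k) `|v i| * ((j ^_ k)%:R * (M / r ^+ j) * (r / 4) ^+ (j - k)) =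
  (j ^_ k)%:R * (M / r ^+ j * \prod_(i < k) `|v i| * (r / 4) ^+ (j - k)) by ring.
rewrite ler_wpM2l ?ler0n //; apply: le_trans H _.
have c0 : 0 <= M / r ^+ j * \prod_(i < k) `|v i|.
  by rewrite mulr_ge0 // divr_ge0 // exprn_ge0 // ltW.
rewrite ler_wpM2l //.
by rewrite lerXn2r // nnegrE // divr_ge0 // ltW.
Qed.

Lemma series_half_bound (u : nat -> Y) (c : R) : (forall n, `|u n| <= c * 2^-1 ^+ n) ->
  series u @ \oo --> limn (series u) /\ `|limn (series u)| <= 2 * c.
Proof.
move=> uc; have [||D [uD Dc]] := @series_geometric_bound R Y u c 2^-1 => //.
  by rewrite invr_ge0 ler0n /= invf_lt1 // ltr1n.
rewrite (cvg_lim _ uD) //; split=> //; apply: le_trans Dc _.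
have -> : 1 - 2^-1 = 2^-1 :> R by lra.
by rewrite invrK mulrC.
Qed.

Lemma pder_cvg k h (v : 'I_k -> X) : `|h| <= r / 4 ->
  series (pder_term h v) @ \oo --> pder h v.
Proof. by move=> hr; have [] := series_half_bound (fun j => pder_term_bound v j hr). Qed.

Lemma pder_bound k h : `|h| <= r / 4 ->
  multilinear_bound (@pder k h) (2 * (M * k`!%:R * (4 / r) ^+ k)).
Proof.
move=> hr v; have [_] := series_half_bound (fun j => pder_term_bound v j hr).
by rewrite -/(pder h v) mulrA.
Qed.

Lemma pder_multilinear k h : `|h| <= r / 4 -> multilinear (@pder k h).
Proof.
move=> hr i v c u w.
set vc := fun _ => _; pose vu := fun l => if l == i then u else v l.
pose vw := fun l => if l == i then w else v l.
have E n : series (pder_term h vc) n =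
    c *: series (pder_term h vu) n + series (pder_term h vw) n.
  rewrite /series /= scaler_sumr -big_split; apply: eq_bigr => j _ /=.
  rewrite /pder_term; have [jk|kj] := ltnP j k.
    by rewrite ffact_small // !scale0r scaler0 addr0.
  rewrite scalerA mulrC -scalerA -scalerDr; congr (_ *: _).
  exact: (symform_multilinear (m := j - k) h (bsym j) (subnKC kj) i v c u w).
have := pder_cvg (v := vc) hr; have -> : series (pder_term h vc) =
    fun n => c *: series (pder_term h vu) n + series (pder_term h vw) n by apply/funext.
move=> cvc; apply: (cvg_unique _ cvc) => //.
by apply: cvgD; [apply: cvgZr; exact: pder_cvg | exact: pder_cvg].
Qed.

(** Termwise [symform_taylor2]. The coefficient [j ^_ k * 'C(j - k, 2)] is at most [j ^_ k.+2], so
    the remainder is summed by [pder_coef_bound] at order [k.+2]. *)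
Lemma pder_taylor k h u (v : 'I_k -> X) : `|h| <= r / 4 -> `|h + u| <= r / 4 ->
  `|pder (h + u) v - pder h v - pder h (vcons u v)| <=
    2 * (M * k.+2`!%:R * (4 / r) ^+ k.+2) * `|u| ^+ 2 * \prod_(i < k) `|v i|.
Proof.
move=> hr hur.
pose w j := pder_term (h + u) v j - pder_term h v j - pder_term h (vcons u v) j.
have wb j : `|w j| <= (M * k.+2`!%:R * (4 / r) ^+ k.+2 * `|u| ^+ 2 * \prod_(i < k) `|v i|)
    * 2^-1 ^+ j.
  have c0 : 0 <= `|u| ^+ 2 * \prod_(i < k) `|v i| by rewrite mulr_ge0 // exprn_ge0.
  apply: (@le_trans _ _ ((`|u| ^+ 2 * \prod_(i < k) `|v i|) *
      ((j ^_ k.+2)%:R * (M / r ^+ j) * (r / 4) ^+ (j - k.+2)))); last first.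
    apply: le_trans (ler_wpM2l c0 (pder_coef_bound k.+2 j)) _.
    by rewrite le_eqVlt; apply/orP; left; apply/eqP; ring.
  rewrite /w /pder_term; have [jk|kj] := ltnP j k.
    have jk1 : (j < k.+1)%N by exact: ltnW.
    have jk2 : (j < k.+2)%N by exact: ltnW.
    by rewrite !ffact_small // !scale0r !subr0 normr0 !mul0r mulr0.
  rewrite codom_vcons ffactnSr natrM -scalerA -!scalerBr subnS.
  rewrite normrZ ger0_norm ?ler0n //.
  have := @symform_taylor2 _ _ _ j _ _ (bsym j) (r / 4) h u _ hr hur (j - k)%N (codom v).
  rewrite size_codom card_ord subnKC // prod_codom.
  rewrite divr_ge0 ?exprn_ge0 ?(ltW r_gt0) // => /(_ isT erefl) H.
  apply: le_trans (ler_wpM2l (ler0n _ _) H) _.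
  have -> : (j ^_ k.+2 = j ^_ k * (j - k) ^_ 2)%N.
    by rewrite !ffactnSr ffactn0 mul1n subn0 -mulnA subnS subn1.
  have -> : (j - k.+2 = j - k - 2)%N by rewrite -addn2 subnDA.
  rewrite natrM.
  have d0 : 0 <= (j ^_ k)%:R * (M / r ^+ j) * (r / 4) ^+ (j - k - 2) * (`|u| ^+ 2 * \prod_(i < k) `|v i|).
    have rj : 0 <= M / r ^+ j by rewrite divr_ge0 // exprn_ge0 // ltW.
    have r4 : 0 <= r / 4 by rewrite divr_ge0 // ltW.
    by rewrite !mulr_ge0 ?invr_ge0 ?ler0n ?exprn_ge0 //; exact: ltW.
  have cb : 'C(j - k, 2)%:R <= ((j - k) ^_ 2)%:R :> R.
    by rewrite ler_nat -bin_ffact leq_pmulr.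
  have := ler_wpM2l d0 cb; congr (_ <= _); ring.
have ws : series w = fun n => series (pder_term (h + u) v) n - series (pder_term h v) n
    - series (pder_term h (vcons u v)) n.
  by apply/funext => n; rewrite /series /= -!sumrB.
have [wc wn] := series_half_bound wb.
have := wn; have -> : limn (series w) = pder (h + u) v - pder h v - pder h (vcons u v).
  apply: cvg_lim => //; rewrite ws.
  by apply: cvgB; [apply: cvgB|]; exact: pder_cvg.
by rewrite !mulrA.
Qed.

Lemma pder_is_mderive k h : `|h| < r / 4 ->
  is_mderive (fun z v => @pder k z v) h (@pder k.+1 h).
Proof.
move=> hr; have hr' := ltW hr; split.
- exact: pder_multilinear.
- by exists (2 * (M * k.+1`!%:R * (4 / r) ^+ k.+1)); exact: pder_bound.
move=> e e0; pose K := 2 * (M * k.+2`!%:R * (4 / r) ^+ k.+2).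
have K0 : 0 <= K.
  rewrite /K mulr_ge0 // mulr_ge0 //; first by rewrite mulr_ge0.
  by rewrite exprn_ge0 // divr_ge0 // ltW.
apply/nbhs_norm0P; exists (Num.min (r / 4 - `|h|) (e / (K + 1))).
  by rewrite /= lt_min subr_gt0 hr divr_gt0 // ltr_wpDl.
move=> u /=; rewrite lt_min => /andP[uh uK] v.
have hur : `|h + u| <= r / 4.
  by apply: le_trans (ler_normD _ _) _; rewrite -lerBrDl ltW.
apply: le_trans (pder_taylor v hr' hur) _; rewrite -/K ler_wpM2r //.
rewrite expr2 mulrA ler_wpM2r //.
have := ltW uK; rewrite ler_pdivlMr ?ltr_wpDl // => H.
by apply: le_trans H; rewrite mulrC ler_wpM2l // lerDl.
Qed.

End PowerSeries.

Section Analytic.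
Context {R : realType} {X : normedModType R} {Y : completeNormedModType R}.

Lemma is_mderive_shift k (G H : X -> ('I_k -> X) -> Y) x h d A :
  (forall u, `|u| < d -> H (x + u) = G u) -> `|h| < d ->
  is_mderive G h A -> is_mderive H (x + h) A.
Proof.
move=> HG hd [Aml Ab HA]; split=> // e e0.
have [d' /= d'0 H'] := (nbhs_norm0P.1 (HA e e0)).
apply/nbhs_norm0P; exists (Num.min d' (d - `|h|)).
  by rewrite /= lt_min d'0 subr_gt0.
move=> u /=; rewrite lt_min => /andP[ud' udh] v.
have hu : `|h + u| < d.
  by rewrite (le_lt_trans (ler_normD _ _)) // addrC -ltrBrDr.
by have := H' u ud' v; rewrite /= -(addrA x) (HG _ hu) (HG _ hd).
Qed.

(** Near [x] the derivatives coincide with [pder], by induction on [k] and uniqueness. [M] and [L]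
    do not depend on [k] or [h]: this is the local factorial growth that [sublinear_continuation]
    consumes. *)
Lemma analytic_nderive (F : X -> Y) (x : X) : analytic_at F x ->
  exists rho M L, [/\ 0 < rho, 0 <= M, 0 <= L & forall k h, `|h| < rho ->
    [/\ is_mderive (nderive F k) (x + h) (nderive F k.+1 (x + h)),
        multilinear (nderive F k (x + h)) &
        multilinear_bound (nderive F k (x + h)) (M * k`!%:R * L ^+ k)]].
Proof.
move=> [r [M [a [r0 aml aM aF]]]].
have M0 : 0 <= M.
  have := aM 0%N (fun=> 0); rewrite expr0 divr1 big_ord0 mulr1.
  exact: le_trans.
pose b j := symmetrize (a j).
have bsym j : symform j (M / r ^+ j) (b j) by exact: symform_symmetrize.
exists (r / 4), (2 * M), (4 / r); split.
- by rewrite divr_gt0.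
- by rewrite mulr_ge0.
- by rewrite divr_ge0 // ltW.
have nE k : forall h, `|h| < r / 4 -> nderive F k (x + h) = pder b h :> (('I_k -> X) -> Y).
  elim: k => [|k IH] h hr.
    apply/funext => v /=; have ct := pder_cvg r0 M0 bsym (v := v) (ltW hr).
    have hr1 : `|h| < r.
      by rewrite (lt_trans hr) // ltr_pdivrMr // ltr_pMr // ltr1n.
    apply: (cvg_unique _ _ ct) => //.
    have -> // : series (pder_term b h v) = series (fun k => a k (fun=> h)).
      apply/funext => n; apply: eq_bigr => j _.
      rewrite /pder_term ffactn0 scale1r subn0.
      have -> : codom v = [::] by apply/eqP; rewrite -size_eq0 size_codom card_ord.
      by rewrite cat0s /b symmetrize_diag.
    exact: aF.
  have D := is_mderive_shift IH hr (pder_is_mderive r0 M0 bsym k hr).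
  rewrite /=; case: xgetP => [A _ HA|/(_ _ D)//].
  exact: mderive_unique HA D.
move=> k h hr; rewrite !nE //; split.
- exact: is_mderive_shift (nE k) hr (pder_is_mderive r0 M0 bsym k hr).
- exact: (pder_multilinear r0 M0 bsym (ltW hr)).
- by move=> v; apply: le_trans (pder_bound r0 M0 bsym (k := k) (ltW hr) v) _; rewrite !mulrA.
Qed.

End Analytic.

(** * Newton's method for the majorant *)

Section Rates.
Context {R : realType} {V : normedModType R}.
Implicit Types (u : nat -> V) (l : V).

Lemma cvg_norm_sub_le u l a (m : nat) (c : R) : u @ \oo --> l ->
  (forall n, (m <= n)%N -> `|u n - a| <= c) -> `|l - a| <= c.
Proof.
move=> ul H.
have cn : (fun n => `|u n - a|) @ \oo --> `|l - a|.
  by apply: cvg_norm; apply: cvgB => //; exact: cvg_cst.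
rewrite -(cvg_lim _ cn) //; apply: limr_le; first exact: cvgP cn.
by exists m.
Qed.

Lemma limn_esup_err_quotient_le (p : nat) u l (c : R) : (0 < p)%N -> 0 <= c ->
  (\forall k \near \oo, `|l - u k.+1| <= c * `|l - u k| ^+ p) ->
  (limn_esup (err_quotient p u l) <= c%:E)%E.
Proof.
move=> p0 c0 [N _ H].
apply: (@le_trans _ _ (ereal_sup (err_quotient p u l @` [set n | (N <= n)%N]))).
  by apply: ereal_inf_lbound; exists [set n | (N <= n)%N] => //; exists N.
apply: ge_ereal_sup => _ [k /H + <-]; rewrite /err_quotient.
(* A zero error forces the next error to be 0 as well, and the quotient is then 0 / 0 = 0. *)
have [e0|e0] := eqVneq (l - u k) 0.
  rewrite e0 normr0 expr0n gtn_eqF // mulr0 normr_le0 => /eqP ->.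
  by rewrite normr0 mul0e.
move=> Hk; have ep : 0 < `|l - u k| ^+ p by rewrite exprn_gt0 // normr_gt0.
by rewrite inver gt_eqF // -EFinM lee_fin ler_pdivrMr.
Qed.

(* Once [K d_k <= eta], the steps [d_k] decrease geometrically with ratio [eta], so the
   error after [k] steps is [d_k] up to a factor tending to 1 with [eta -> 0]. *)
Lemma quadratic_steps_limn_esup u l (K : R) : 0 < K -> u @ \oo --> l ->
  (forall k, `|u k.+2 - u k.+1| <= K * `|u k.+1 - u k| ^+ 2) ->
  (limn_esup (err_quotient 2 u l) <= K%:E)%E.
Proof.
move=> K0 ul HK; apply/lee_addgt0Pr => eps eps0; rewrite -EFinD.
apply: limn_esup_err_quotient_le => //; first by rewrite addr_ge0 // ltW.
(* For [eta <= 1 / 4] one has [1 - eta <= (1 + 12 * eta) * (1 - 2 * eta) ^+ 2], the inequality that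
   ends the proof; the other bound turns [K * (1 + 12 * eta)] into at most [K + eps]. *)
pose eta := Num.min (1 / 4) (eps / (12 * K)).
have eta0 : 0 < eta by rewrite lt_min !divr_gt0 // mulr_gt0.
have eta4 : eta <= 1 / 4 by rewrite ge_min lexx.
have etaK : 12 * K * eta <= eps.
  by rewrite mulrC -ler_pdivlMr ?mulr_gt0 // ge_min lexx orbT.
pose d k := `|u k.+1 - u k|.
have d_ge0 k : 0 <= d k by exact: normr_ge0.
have d_cvg : d @ \oo --> 0.
  rewrite -(normr0 V) -(subrr l); apply: cvg_norm; apply: cvgB => //.
  by rewrite (cvg_shiftS u).
have [N _ HN] : \forall k \near \oo, d k <= eta / K.
  have : \forall k \near \oo, `|0 - d k| <= eta / K.
    by move/cvgrPdist_le : d_cvg; apply; rewrite divr_gt0.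
  by apply: filterS => k; rewrite sub0r normrN ger0_norm.
have dS k : (N <= k)%N -> d k.+1 <= eta * d k.
  move=> /HN dk; apply: le_trans (HK k) _; rewrite -/(d k) expr2 mulrA ler_wpM2r //.
  by rewrite mulrC -ler_pdivlMr.
have err k : (N <= k)%N -> `|l - u k| <= d k / (1 - eta).
  move=> Nk; apply: (cvg_norm_sub_le ul (m := k)) => n /subnKC <-.
  have dn i : d (k + i)%N <= eta ^+ i * d k.
    elim: i => [|i IH]; first by rewrite addn0 expr0 mul1r.
    rewrite addnS exprS -mulrA; apply: le_trans (dS _ _) _; first by rewrite (leq_trans Nk) ?leq_addr.
    by rewrite ler_wpM2l // ltW.
  have un i : `|u (k + i)%N - u k| <= d k * (1 - eta ^+ i) / (1 - eta).
    elim: i => [|i IH]; first by rewrite addn0 subrr normr0 expr0 subrr mulr0 mul0r.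
    rewrite addnS -(subrK (u (k + i)%N) (u (k + i).+1)) -addrA.
    apply: le_trans (ler_normD _ _) _; apply: le_trans (lerD (dn i) IH) _.
    rewrite le_eqVlt exprS; apply/orP; left; apply/eqP; field.
    by rewrite gt_eqF //; lra.
  apply: le_trans (un _) _; rewrite ler_pM2r; last by rewrite invr_gt0; lra.
  by rewrite ler_piMr // gerBl exprn_ge0 // ltW.
near=> k.
have Nk : (N <= k)%N by near: k; exists N.
have e1 : `|l - u k.+1| <= d k.+1 / (1 - eta) by apply: err; exact: leq_trans Nk _.
have e2 : d k <= `|l - u k| + `|l - u k.+1|.
  rewrite /d -(subrKA l) addrC; apply: le_trans (ler_normD _ _) _.
  by rewrite lerD2l distrC.
have eta1 : 0 < 1 - eta by lra.
have e3 : `|l - u k.+1| * (1 - eta) <= K * d k ^+ 2.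
  by rewrite -ler_pdivlMr //; apply: le_trans e1 _; rewrite ler_pM2r ?invr_gt0 //; exact: HK.
have e4 : `|l - u k.+1| * (1 - eta) <= eta * d k.
  by rewrite -ler_pdivlMr //; apply: le_trans e1 _; rewrite ler_pM2r ?invr_gt0 //; exact: dS.
(* The current error is bounded below by the current step: the step is at most the sum of two
   consecutive errors, and by [e4] the second of them is small against the step. *)
have e5 : d k * (1 - 2 * eta) <= `|l - u k| * (1 - eta).
  have := ler_wpM2r (ltW eta1) e2; rewrite mulrDl => H.
  have -> : d k * (1 - 2 * eta) = d k * (1 - eta) - eta * d k by ring.
  lra.
have e6 : d k ^+ 2 * (1 - 2 * eta) ^+ 2 <= `|l - u k| ^+ 2 * (1 - eta) ^+ 2.
  rewrite -!exprMn lerXn2r // nnegrE mulr_ge0 //; lra.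
rewrite -(ler_pM2r eta1); apply: le_trans e3 _.
have t0 : 0 < (1 - 2 * eta) ^+ 2 by rewrite exprn_gt0 //; lra.
rewrite -(ler_pM2r t0).
apply: (@le_trans _ _ (K * (`|l - u k| ^+ 2 * (1 - eta) ^+ 2))).
  by rewrite -mulrA ler_pM2l.
have -> : (K + eps) * `|l - u k| ^+ 2 * (1 - eta) * (1 - 2 * eta) ^+ 2 =
   (`|l - u k| ^+ 2 * (1 - eta)) * ((K + eps) * (1 - 2 * eta) ^+ 2) by ring.
have -> : K * (`|l - u k| ^+ 2 * (1 - eta) ^+ 2) =
   (`|l - u k| ^+ 2 * (1 - eta)) * (K * (1 - eta)) by ring.
rewrite ler_wpM2l //; first by rewrite mulr_ge0 ?exprn_ge0 // ltW.
apply: (@le_trans _ _ (K * (1 + 12 * eta) * (1 - 2 * eta) ^+ 2)).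
  rewrite -mulrA ler_pM2l //.
  have -> : (1 + 12 * eta) * (1 - 2 * eta) ^+ 2 =
    (1 - eta) + eta * (1 + (1 / 4 - eta) * (32 - 48 * eta)) by field.
  rewrite lerDl mulr_ge0 ?(ltW eta0) // addr_ge0 // mulr_ge0 //; lra.
rewrite ler_pM2r //; lra.
Unshelve. all: by end_near. Qed.

End Rates.

Section MajorantNewton.
Context {R : realType}.
Variables (g b : R).
Hypotheses (g_gt0 : 0 < g) (b_gt0 : 0 < b).
Hypothesis alpha_le : b * g <= 3 - 2 * Num.sqrt 2.

Let f := majorant g b.
Let ts := tstar g b.
Let s := 1 - g * ts.

Let r2 : R := Num.sqrt 2.
Let r2sq : r2 ^+ 2 = 2. Proof. by rewrite sqr_sqrtr. Qed.
Let r2_gt0 : 0 < r2. Proof. by rewrite sqrtr_gt0. Qed.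

Let disc := (b * g + 1) ^+ 2 - 8 * (b * g).
Let al_gt0 : 0 < b * g. Proof. exact: mulr_gt0. Qed.

(** [disc] equals [(3 - b * g) ^+ 2 - 8]. *)
Let disc_ge0 : 0 <= disc.
Proof.
have H : 2 * r2 <= 3 - b * g by move: alpha_le; rewrite -/r2; lra.
have : (2 * r2) ^+ 2 <= (3 - b * g) ^+ 2.
  by rewrite lerXn2r // nnegrE ?mulr_ge0 ?(ltW r2_gt0) // (le_trans _ H) // mulr_ge0 // ltW.
by rewrite exprMn r2sq /disc => H2; nra.
Qed.

Let q := Num.sqrt disc.
Let qsq : q ^+ 2 = disc. Proof. exact: sqr_sqrtr. Qed.
Let q_ge0 : 0 <= q. Proof. exact: sqrtr_ge0. Qed.
Let gts : g * ts = (b * g + 1 - q) / 4.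
Proof. by rewrite /ts /tstar -/disc -/q; field; rewrite gt_eqF. Qed.

Lemma tstar_gt0 : 0 < ts.
Proof.
rewrite -(pmulr_rgt0 _ g_gt0) gts divr_gt0 // subr_gt0.
rewrite -(@ltr_pXn2r _ 2) ?nnegrE ?addr_ge0 ?(ltW al_gt0) // qsq /disc.
by rewrite gtrBl mulr_gt0.
Qed.

(** [f' t = a^-2 - 2] with [a = 1 - g * t] vanishes where [2 * a] is the square root of 2. So [ts]
    does not lie beyond the minimum of [f]. *)
Lemma sqrt2_le_tstar : r2 <= 2 * s.
Proof. by rewrite /s gts; move: alpha_le; rewrite -/r2; have := q_ge0; lra. Qed.

Lemma sqrt2_lt_tstar : b * g < 3 - 2 * Num.sqrt 2 -> r2 < 2 * s.
Proof. by rewrite /s gts -/r2; have := q_ge0; lra. Qed.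

Let s_gt0 : 0 < s.
Proof. by have := sqrt2_le_tstar; have := r2_gt0; lra. Qed.
Let s_sq : 1 <= 2 * s ^+ 2.
Proof. by have := sqrt2_le_tstar; have := r2_gt0; have := r2sq; nra. Qed.

Lemma tstar_sq_gt : b * g < 3 - 2 * Num.sqrt 2 -> 1 < 2 * s ^+ 2.
Proof. by move/sqrt2_lt_tstar; have := r2_gt0; have := r2sq; nra. Qed.

Lemma tstar_lt : ts < g^-1.
Proof. by rewrite -[_^-1]mul1r ltr_pdivlMr //; have := s_gt0; rewrite /s; lra. Qed.

Lemma majorant_quadratic t : 1 - g * t != 0 ->
  f t * (1 - g * t) = 2 * g * t ^+ 2 - (b * g + 1) * t + b.
Proof. by move=> h; rewrite /f /majorant; field. Qed.

Lemma tstar_quadratic : 2 * g * ts ^+ 2 - (b * g + 1) * ts + b = 0.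
Proof.
apply: (mulfI (lt0r_neq0 g_gt0)); rewrite mulr0.
have -> : g * (2 * g * ts ^+ 2 - (b * g + 1) * ts + b) =
  2 * (g * ts) ^+ 2 - (b * g + 1) * (g * ts) + b * g by ring.
have := qsq; rewrite gts /disc => qq.
have -> : 2 * ((b * g + 1 - q) / 4) ^+ 2 - (b * g + 1) * ((b * g + 1 - q) / 4) + b * g =
  (q ^+ 2 - ((b * g + 1) ^+ 2 - 8 * (b * g))) / 8 by field.
by rewrite qq subrr mul0r.
Qed.

Lemma majorant_smallest_zero : smallest_zero_on `[0, g^-1[ f ts.
Proof.
have n0 : s != 0 by rewrite gt_eqF.
split.
- by rewrite /= in_itv /= tstar_lt ltW // tstar_gt0.
- by apply: (mulIf n0); rewrite mul0r majorant_quadratic // tstar_quadratic.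
move=> t; rewrite /= in_itv /= => /andP[t0 tg] ft; rewrite leNgt; apply/negP => tts.
have tg' : 0 < 1 - g * t by rewrite subr_gt0 mulrC -ltr_pdivlMr // div1r.
have := majorant_quadratic (lt0r_neq0 tg'); rewrite ft mul0r => /esym.
(* The second factor equals [q + 2 * (g * ts - g * t)], which is positive for [t < ts]. *)
have -> : 2 * g * t ^+ 2 - (b * g + 1) * t + b =
   (2 * g * ts ^+ 2 - (b * g + 1) * ts + b) + (ts - t) * ((b * g + 1) - 2 * (g * ts) - 2 * (g * t)) by ring.
rewrite tstar_quadratic add0r => /eqP; rewrite mulf_eq0 !subr_eq0 gt_eqF //=.
apply/negP; rewrite gt_eqF //.
have : g * t < g * ts by rewrite ltr_pM2l.
by have := q_ge0; have := gts; lra.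
Qed.

Lemma majorant_derive1 t : 1 - g * t != 0 -> derive1 f t = (1 - g * t) ^- 2 - 2.
Proof.
move=> h; have d1 := is_derive_invr_exp 1 1 h.
have -> : f = (@id R * (fun y => 1 / (1 - g * y) ^+ 1) - 2 *: @id R + cst b)%R.
  by apply/funext => y; rewrite !fctE /f /majorant expr1 mul1r.
rewrite derive1E; apply: derive_val.
apply: is_derive_eq; rewrite /GRing.scale /= !expr1.
by field.
Qed.

(** The equation [f ts = 0] solved for [b]; the formulas of a Newton step can then be written in [a]
    and [s] alone. *)
Lemma majorant_bE : b = 2 * ts - ts / s.
Proof.
have := tstar_quadratic; rewrite /s => H.
have h : 1 - g * ts != 0 by rewrite gt_eqF.
apply: (mulIf h); rewrite mulrBl divfK //.
have -> : b * (1 - g * ts) = (2 * g * ts ^+ 2 - (b * g + 1) * ts + b) - 2 * g * ts ^+ 2 + ts by ring.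
by rewrite H; ring.
Qed.

Definition newton_map t := t - f t / derive1 f t.

Section Step.
Variable t : R.
Hypothesis t_lt : t < ts.
Let a := 1 - g * t.

Let sa : s < a. Proof. by rewrite /s /a ltrD2l ltrN2 ltr_pM2l. Qed.
Let a_gt0 : 0 < a.
Proof. exact: lt_trans s_gt0 sa. Qed.

Lemma step_sq_gt : 0 < 2 * a ^+ 2 - 1.
Proof. by have := sa; have := s_gt0; have := s_sq; nra. Qed.

Let as_gt : 0 < 2 * a * s - 1.
Proof. by have := sa; have := s_gt0; have := s_sq; nra. Qed.

Lemma step_derive1 : derive1 f t = - ((2 * a ^+ 2 - 1) / a ^+ 2).
Proof. by rewrite majorant_derive1 ?gt_eqF // -/a; field; rewrite gt_eqF. Qed.

Lemma step_derive1_neq0 : derive1 f t != 0.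
Proof. by rewrite step_derive1 oppr_eq0 gt_eqF // divr_gt0 ?exprn_gt0 // step_sq_gt. Qed.

Lemma step_majorant : f t = (ts - t) * (2 * a * s - 1) / (a * s).
Proof.
rewrite /f /majorant [X in _ + X]majorant_bE -/a /s /a; field.
by rewrite -/s -/a !gt_eqF.
Qed.

Lemma newton_mapE : newton_map t =
  t + (ts - t) * (2 * a * s - 1) * a / (s * (2 * a ^+ 2 - 1)).
Proof.
rewrite /newton_map step_majorant step_derive1; field.
by have := step_sq_gt => h; rewrite !gt_eqF.
Qed.

Lemma newton_map_gap : ts - newton_map t = g * (ts - t) ^+ 2 / (s * (2 * a ^+ 2 - 1)).
Proof.
have h := step_sq_gt.
rewrite newton_mapE; have -> : ts = (1 - s) / g by rewrite /s; field; rewrite gt_eqF.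
have -> : t = (1 - a) / g by rewrite /a; field; rewrite gt_eqF.
by field; rewrite !gt_eqF.
Qed.

Lemma newton_map_gt : t < newton_map t.
Proof.
have tt : 0 < ts - t by rewrite subr_gt0.
rewrite newton_mapE ltrDl; apply: divr_gt0; last exact: mulr_gt0 s_gt0 step_sq_gt.
by rewrite !mulr_gt0.
Qed.

Lemma newton_map_lt : newton_map t < ts.
Proof.
have tt : 0 < ts - t by rewrite subr_gt0.
rewrite -subr_gt0 newton_map_gap; apply: divr_gt0; last exact: mulr_gt0 s_gt0 step_sq_gt.
by rewrite mulr_gt0 // exprn_gt0.
Qed.

(** As [g * (ts - t) = a - s], the claim reads [2 * a <= s * (2 * a ^+ 2 + 1)]. It follows from
    [r2 <= 2 * s] and the square of [2 * a - r2]. The ratio 1/2 is the limiting one at the double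
    root, when [b * g] takes its largest value. *)
Lemma newton_map_half : ts - newton_map t <= 2^-1 * (ts - t).
Proof.
rewrite newton_map_gap ler_pdivrMr ?mulr_gt0 ?step_sq_gt //.
have -> : g * (ts - t) ^+ 2 = (ts - t) * (a - s) by rewrite /a /s; ring.
rewrite -mulrA [2^-1 * _]mulrCA ler_pM2l ?subr_gt0 // ler_pdivlMl //.
have := sqrt2_le_tstar; rewrite -/s => H.
have sg := sa; have := mulr_ge0 (ltW s_gt0) (sqr_ge0 (a - s)).
have := s_sq; have h := step_sq_gt.
have := sqr_ge0 (2 * a - r2); have := r2sq; have := r2_gt0.
have h2 : r2 * a ^+ 2 <= 2 * s * a ^+ 2 by rewrite ler_wpM2r // exprn_ge0 // ltW.
move=> r0 rr h3 _ _.
have h4 : r2 * (2 * a) ^+ 2 - 4 * r2 ^+ 2 * a + r2 ^+ 3 >= 0.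
  by have := mulr_ge0 (ltW r0) h3; congr (_ <= _); ring.
have : r2 ^+ 3 = 2 * r2 by rewrite exprS rr mulrC.
by move: h4; rewrite rr exprMn => h4 h5; lra.
Qed.

(** The tangent at [t] vanishes at the new point, so only the second-order remainder of [f] is left.
    It is the bound of [taylor_remainder_bound] with [t] for |h| and the step for |d|. *)
Lemma newton_map_majorant :
  f (newton_map t) = g * (newton_map t - t) ^+ 2 / (a ^+ 2 * (1 - g * newton_map t)).
Proof.
have h := step_sq_gt; have h' := newton_map_lt.
have n0 : 0 < 1 - g * newton_map t.
  apply: lt_trans s_gt0 _; rewrite /s ltrD2l ltrN2 ltr_pM2l //.
have ftE : f t = (newton_map t - t) * ((2 * a ^+ 2 - 1) / a ^+ 2).
  rewrite /newton_map step_derive1; field; by rewrite !gt_eqF.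
move: (newton_map t) n0 ftE {h'} => y n0; rewrite /f /majorant -/a.
move=> /(congr1 (fun z => z - t / a + 2 * t)).
have -> : t / a - 2 * t + b - t / a + 2 * t = b by ring.
move=> ->; have -> : t = (1 - a) / g by rewrite /a; field; rewrite gt_eqF.
by field; rewrite !gt_eqF.
Qed.

Lemma newton_map_quad : 1 < 2 * s ^+ 2 ->
  ts - newton_map t <= quad_const g ts * (ts - t) ^+ 2.
Proof.
move=> s1; have h := step_sq_gt; rewrite newton_map_gap /quad_const -/s mulrAC.
have c1 : 0 < s * (2 * s ^+ 2 - 1) by rewrite mulr_gt0 // subr_gt0.
have c2 : 0 < s * (2 * a ^+ 2 - 1) by rewrite mulr_gt0.
apply: ler_wpM2r; first by rewrite exprn_ge0 // subr_ge0 ltW.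
rewrite ler_pM2l // lef_pV2 ?posrE // ler_pM2l // lerD2r ler_pM2l //.
by rewrite lerXn2r // ?nnegrE; apply: ltW.
Qed.

End Step.

Local Notation tk := (real_newton f 0).

Lemma real_newtonS k : tk k.+1 = newton_map (tk k).
Proof. by []. Qed.

Lemma real_newton_bounds k : 0 <= tk k < ts.
Proof.
elim: k => [|k /andP[IH0 IH]]; first by rewrite lexx tstar_gt0.
rewrite real_newtonS newton_map_lt // andbT.
exact: le_trans IH0 (ltW (newton_map_gt IH)).
Qed.

Let tk0 k : 0 <= tk k. Proof. by have /andP[] := real_newton_bounds k. Qed.
Let tkts k : tk k < ts. Proof. by have /andP[] := real_newton_bounds k. Qed.

Lemma real_newton_inc k : tk k < tk k.+1.
Proof. exact: newton_map_gt. Qed.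

Lemma real_newton_half k : ts - tk k.+1 <= 2^-1 * (ts - tk k).
Proof. exact: newton_map_half. Qed.

Lemma real_newton_geometric k : ts - tk k <= ts * 2^-1 ^+ k.
Proof.
elim: k => [|k IH]; first by rewrite subr0 expr0 mulr1.
apply: le_trans (real_newton_half k) _; rewrite exprS mulrCA.
by rewrite ler_wpM2l // invr_ge0.
Qed.

Lemma real_newton_cvg : tk @ \oo --> ts.
Proof.
have le := real_newton_geometric.
have H : (fun k => ts - tk k) @ \oo --> (0 : R).
  apply: (@squeeze_cvgr _ _ _ _ (cst 0) (fun k => ts * 2^-1 ^+ k)).
  - by near=> k; rewrite le subr_ge0 ltW.
  - exact: cvg_cst.
  - rewrite -[X in _ --> X](mulr0 ts); apply: cvgMr; apply: cvg_expr.
    by rewrite ger0_norm ?invr_ge0 ?ler0n // invf_lt1 // ltr1n.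
have -> : tk = fun k => ts - (ts - tk k) by apply/funext => k; rewrite opprB addrC subrK.
rewrite -[X in _ --> X](subr0 ts); apply: cvgB => //; exact: cvg_cst.
Unshelve. all: by end_near. Qed.

Lemma real_newton_quad k : b * g < 3 - 2 * Num.sqrt 2 ->
  ts - tk k.+1 <= quad_const g ts * (ts - tk k) ^+ 2.
Proof. by move=> /tstar_sq_gt; exact: newton_map_quad. Qed.

Lemma real_newton_step k : tk k.+1 - tk k =
  f (tk k) / ((2 * (1 - g * tk k) ^+ 2 - 1) / (1 - g * tk k) ^+ 2).
Proof.
rewrite real_newtonS /newton_map step_derive1 // invrN mulrN opprK addrC addKr //.
Qed.

Lemma real_newton_step1 : tk 1 = b.
Proof.
have := real_newton_step 0; rewrite /= subr0 => ->.
have -> : f 0 = b by rewrite /f /majorant mulr0 mul0r mulr0 subr0 add0r.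
by rewrite mulr0 subr0 expr1n; field.
Qed.

Lemma real_newton_stepS k : tk k.+2 - tk k.+1 =
  g * (tk k.+1 - tk k) ^+ 2 / ((1 - g * tk k) ^+ 2 * (1 - g * tk k.+1))
  / ((2 * (1 - g * tk k.+1) ^+ 2 - 1) / (1 - g * tk k.+1) ^+ 2).
Proof. by rewrite real_newton_step {1}real_newtonS newton_map_majorant. Qed.

Lemma real_newton_gt k : s < 1 - g * tk k.
Proof. by rewrite /s ltrD2l ltrN2 ltr_pM2l. Qed.

Lemma quad_const_gt0 : b * g < 3 - 2 * Num.sqrt 2 -> 0 < quad_const g ts.
Proof.
by move=> /tstar_sq_gt h; rewrite /quad_const -/s divr_gt0 // mulr_gt0 // subr_gt0.
Qed.

(** After cancellation the factor of [g * D2] is [a' / (a ^+ 2 * (2 * a' ^+ 2 - 1))]; it is compared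
    with the constant through [s * a' <= a ^+ 2] and [s <= a']. *)
Lemma real_newton_step_quad k : b * g < 3 - 2 * Num.sqrt 2 ->
  tk k.+2 - tk k.+1 <= quad_const g ts * (tk k.+1 - tk k) ^+ 2.
Proof.
move=> hs; have h := tstar_sq_gt hs; rewrite real_newton_stepS.
have := real_newton_gt k; have := real_newton_gt k.+1.
set D2 := (tk k.+1 - tk k) ^+ 2; have D20 : 0 <= D2 by rewrite sqr_ge0.
have aa : 1 - g * tk k.+1 <= 1 - g * tk k.
  by rewrite lerD2l lerN2 ler_pM2l // ltW // real_newton_inc.
move: aa; set a := 1 - g * tk k; set a' := 1 - g * tk k.+1 => aa sa' sa.
have a0 : 0 < a by apply: lt_trans sa. have a'0 : 0 < a' by apply: lt_trans sa'.
have sa2 : s ^+ 2 <= a' ^+ 2 by rewrite lerXn2r // ?nnegrE ?ltW.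
have d0 : 0 < 2 * a' ^+ 2 - 1 by lra.
have s0 : 0 < 2 * s ^+ 2 - 1 by lra.
have -> : g * D2 / (a ^+ 2 * a') / ((2 * a' ^+ 2 - 1) / a' ^+ 2) =
   g * D2 * (a' / (a ^+ 2 * (2 * a' ^+ 2 - 1))) by field; rewrite !gt_eqF.
rewrite /quad_const -/s [in leRHS]mulrAC ler_wpM2l //; first by rewrite mulr_ge0 // ltW.
rewrite ler_pdivrMr ?mulr_gt0 ?exprn_gt0 // ler_pdivlMl ?mulr_gt0 //.
have -> : s * (2 * s ^+ 2 - 1) * a' = (s * a') * (2 * s ^+ 2 - 1) by ring.
apply: ler_pM; [by rewrite mulr_ge0 // ltW | exact: ltW | | lra].
by rewrite expr2 ler_pM // ltW.
Qed.

End MajorantNewton.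

(** * Newton's method for the inclusion *)

Section ConeFacts.
Context {R : realType} {Y : normedModType R} (C : set Y).
Hypotheses (C_cone : closed_convex_cone C) (C_n0 : C !=set0).

(** A sum is twice a midpoint. *)
Lemma cone_add x y : C x -> C y -> C (x + y).
Proof.
have [_ cvx sc] := C_cone; move=> Cx Cy.
have h0 : (0 : R) <= 2^-1 by rewrite invr_ge0.
have h1 : (2^-1 : R) <= 1 by rewrite invf_le1 // ler1n.
have := cvx x y (Itv01 h0 h1) (mem_set Cx) (mem_set Cy) => /set_mem /=.
move=> /(sc 2 _ (ltr0n _ 2)); rewrite /conv /= scalerDr !scalerA.
have -> : 2 * 2^-1 = 1 :> R by rewrite divff.
have -> : 2 * unstable.onem 2^-1 = 1 :> R by rewrite /unstable.onem; field.
by rewrite !scale1r.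
Qed.

(** Only positive multiples are given, so 0 is reached as the limit of [2 ^- n *: y]. *)
Lemma cone_0 : C 0.
Proof.
have [cl _ sc] := C_cone; have [y Cy] := C_n0.
apply: (@closed_cvg _ _ \oo _ (fun n => (2^-1 : R) ^+ n *: y) C) => //.
  by apply: nearW => n; apply: sc => //; rewrite exprn_gt0 // invr_gt0.
rewrite -[X in _ --> X](scale0r y); apply: cvgZl; apply: cvg_expr.
by rewrite ger0_norm ?invr_ge0 ?ler0n // invf_lt1 // ltr1n.
Qed.

Lemma cone_scale (a : R) y : 0 <= a -> C y -> C (a *: y).
Proof.
have [_ _ sc] := C_cone.
by rewrite le_eqVlt => /predU1P[<- _|a0]; [rewrite scale0r; exact: cone_0 | exact: sc].
Qed.

End ConeFacts.

Section Derivatives.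
Context {R : realType} {X Y : normedModType R}.

Lemma mderive_curve k (G : X -> ('I_k -> X) -> Y) (x h : X) (s : R) A v :
  is_mderive G (x + s *: h) A ->
  curve_deriv (fun s => G (x + s *: h) v) s (A (vcons h v)).
Proof.
move=> [Aml _ HA] e e0; pose P := \prod_(i < k) `|v i|.
have P0 : 0 <= P by exact: prodr_ge0.
have h1 : 0 < `|h| + 1 by rewrite ltr_wpDl.
have P1 : 0 < P + 1 by rewrite ltr_wpDl.
have e10 : 0 < e / ((`|h| + 1) * (P + 1)) by rewrite divr_gt0 // mulr_gt0.
have [d /= d0 H] := nbhs_norm0P.1 (HA _ e10).
apply/nbhs_norm0P; exists (d / (`|h| + 1)); first by rewrite /= divr_gt0.
move=> t /=; rewrite ltr_pdivlMr // => td.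
have thd : `|t *: h| < d.
  by rewrite normrZ; apply: le_lt_trans td; rewrite ler_wpM2l // lerDl.
have := H _ thd v; rewrite /= -(addrA x) -scalerDl.
have lin := multilinear_vconsE v Aml.
have A0 : A (vcons 0 v) = 0 by have := lin (-1) 0 0; rewrite scaler0 addr0 scaleN1r addNr.
have -> : A (vcons (t *: h) v) = t *: A (vcons h v).
  by have := lin t h 0; rewrite /= !addr0 A0 addr0.
move/le_trans; apply; rewrite normrZ -/P.
have -> : e / ((`|h| + 1) * (P + 1)) * (`|t| * `|h|) * P =
    e * `|t| * ((`|h| / (`|h| + 1)) * (P / (P + 1))).
  by field; rewrite !gt_eqF.
rewrite ler_piMr ?mulr_ge0 ?(ltW e0) // mulr_ile1 ?divr_ge0 ?(ltW h1) ?(ltW P1) //.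
  by rewrite ler_pdivrMr // mul1r lerDl.
by rewrite ler_pdivrMr // mul1r lerDl.
Qed.

Definition vnil : 'I_0 -> X := fun=> 0.

Lemma prod_vcons k u (v : 'I_k -> X) :
  \prod_(i < k.+1) `|vcons u v i| = `|u| * \prod_(i < k) `|v i|.
Proof.
rewrite big_ord_recl /vcons unlift_none; congr (_ * _).
by apply: eq_bigr => i _; rewrite liftK.
Qed.

(** Links the differential ['d F x], which defines the Newton step, with the first of the iterated
    derivatives, on which the estimates are made. *)
Lemma mderive_diff (F : X -> Y) x A : is_mderive (nderive F 0) x A ->
  differentiable F x /\ forall d, 'd F x d = A (vcons d vnil).
Proof.
move=> [Aml [M AM] HA].
pose L := fun d => A (vcons d vnil).
have lin : linear L := multilinear_vconsE vnil Aml.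
pose cl := GRing.isLinear.Build R X Y *:%R L lin.
pose LL : {linear X -> Y} := HB.pack L cl.
have LM d : `|L d| <= M * `|d|.
  by have := AM (vcons d vnil); rewrite prod_vcons big_ord0 mulr1.
have Lcont : continuous LL.
  apply: bounded_linear_continuous; apply/linear_boundedP.
  exists `|M|; split; first exact: num_real.
  move=> r Mr d; apply: le_trans (LM d) _; rewrite ler_wpM2r //.
  exact: le_trans (ler_norm _) (ltW Mr).
have little : F \o shift x = cst (F x) + LL +o_0 id.
  apply/eqaddoP => e e0; have := HA _ e0; apply: filterS => h /(_ vnil).
  rewrite big_ord0 mulr1 /= => H; rewrite !fctE /= opprD addrA.
  by rewrite [h + x]addrC.
have dE := diff_unique Lcont little.
split; last by move=> d; rewrite dE.
by apply/diff_locallyP; rewrite dE; split.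
Qed.

Lemma multilinear0 k (A : ('I_k -> X) -> Y) v i : multilinear A -> v i = 0 -> A v = 0.
Proof.
move=> /(_ i v) lin vi; have E : v = fun j => if j == i then 0 else v j.
  by apply/funext => j; case: eqVneq => // ->.
by rewrite E; have := lin (-1) 0 0; rewrite scaler0 addr0 scaleN1r addNr.
Qed.

Lemma multilinear_scale k (A : ('I_k -> X) -> Y) (c : 'I_k -> R) v : multilinear A ->
  A (fun i => c i *: v i) = (\prod_(i < k) c i) *: A v.
Proof.
move=> Aml.
(* Only the first [n] arguments are scaled in [w n]; the induction scales one more at a time. *)
pose w n (i : 'I_k) := if (i < n)%N then c i *: v i else v i.
suff H n : (n <= k)%N -> A (w n) = (\prod_(i < k | (i < n)%N) c i) *: A v.
  have := H k (leqnn _).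
  have -> : w k = fun i => c i *: v i by apply/funext => i; rewrite /w ltn_ord.
  by move=> ->; congr (_ *: _); apply: eq_bigl => i; rewrite ltn_ord.
elim: n => [_|n IH nk]; first by rewrite big_pred0 ?scale1r.
pose i0 : 'I_k := Ordinal nk.
have neq_n (i : 'I_k) : i != i0 -> (i == n :> nat) = false.
  by move=> ni; apply: contraNF ni => /eqP e; apply/eqP/val_inj.
have wE z : (fun i => if i == i0 then z else w n i) = (fun i => if i == i0 then z else w n.+1 i).
  apply/funext => i; case: eqVneq => // ni.
  by rewrite /w [in RHS]ltnS [in RHS]leq_eqVlt neq_n.
have wn : w n = fun i => if i == i0 then v i0 else w n i.
  by apply/funext => i; case: eqVneq => // ->; rewrite /w /= ltnn.
have wSn : w n.+1 = fun i => if i == i0 then c i0 *: v i0 else w n i.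
  by rewrite wE; apply/funext => i; case: eqVneq => // ->; rewrite /w /= ltnSn.
have := Aml i0 (w n) (c i0) (v i0) 0; rewrite /= addr0.
have -> : A (fun j => if j == i0 then 0 else w n j) = 0.
  by apply: (@multilinear0 _ _ _ i0) => //; rewrite eqxx.
rewrite addr0 -wn -wSn => ->; rewrite IH ?(ltnW nk) // scalerA; congr (_ *: _).
rewrite [RHS](bigD1 i0) //=; congr (_ * _); apply: eq_bigl => i.
rewrite ltnS andbC; case: eqVneq => [->|ni] /=; first by rewrite ltnn.
by rewrite [in RHS]leq_eqVlt neq_n ?andbT.
Qed.

End Derivatives.

(** * Derivatives at the starting point in terms of gamma *)

Section SmaleBounds.
Context {R : realType} {X Y : completeNormedModType R}.
Variables (F : X -> Y) (C : set Y) (x0 : X).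
Hypothesis onto : forall y, exists d, C ('d F x0 d - y).

Local Notation p := (proc_norm ('d F x0) C).

Lemma proc_norm_set_norm y (r : R) : (set_norm (Tinv F C x0 y) <= r%:E)%E -> p y <= r.
Proof.
move=> H; apply/ler_addgt0Pr => e e0.
have : (set_norm (Tinv F C x0 y) < (r + e)%:E)%E.
  by apply: le_lt_trans H _; rewrite lte_fin ltrDl.
move=> /ereal_inf_lt[_ [d Cd <-]]; rewrite lte_fin => /ltW.
exact/le_trans/proc_norm_le.
Qed.

Hypotheses (C0 : C 0) (C_add : forall x y, C x -> C y -> C (x + y)).
Hypothesis C_scale : forall (a : R) y, 0 <= a -> C y -> C (a *: y).

(** [comp_norm] tests unit vectors only, so the arguments are normalized by multilinearity and
    positive homogeneity of [p]; a zero argument makes the value 0. The exponent [1 / (k - 1)] is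
    undone by raising to the power [k.-1]. *)
Lemma smale_gamma_bound (gamma : R) k v : 0 < gamma ->
  smale_gamma F C x0 = gamma%:E -> (1 < k)%N -> multilinear (nderive F k x0) ->
  p (nderive F k x0 v) <= k`!%:R * gamma ^+ k.-1 * \prod_(i < k) `|v i|.
Proof.
move=> g0 gE k1 ml; have psub := proc_norm_sublinear C0 C_add C_scale onto.
have [/existsP[i /eqP vi0]|/existsPn vn0] := boolP [exists i, v i == 0].
  rewrite (multilinear0 ml vi0) (sublinear0 psub).
  by rewrite mulr_ge0 ?prodr_ge0 // mulr_ge0 // exprn_ge0 // ltW.
have n0 i : 0 < `|v i| by rewrite normr_gt0.
pose w i := `|v i|^-1 *: v i.
have w1 i : `|w i| = 1 by rewrite normrZ normfV normr_id mulVf // gt_eqF.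
have -> : v = fun i => `|v i| *: w i.
  by apply/funext => i; rewrite /w scalerA divff ?scale1r // gt_eqF.
rewrite multilinear_scale // psub.2 ?prodr_ge0 //.
have -> : \prod_(i < k) `| `|v i| *: w i | = \prod_(i < k) `|v i|.
  by apply: eq_bigr => i _; rewrite normrZ w1 mulr1 normr_id.
rewrite mulrC ler_wpM2r ?prodr_ge0 //.
have kf : 0 < k`!%:R :> R by rewrite ltr0n fact_gt0.
rewrite -ler_pdivrMl // -psub.2 ?invr_ge0 ?(ltW kf) //.
apply: proc_norm_set_norm.
pose cn := comp_norm (Tinv F C x0) (fun v => (k`!%:R)^-1 *: nderive F k x0 v).
apply: (@le_trans _ _ cn).
  by apply: ereal_sup_ubound; right; exists w.
have cn0 : (0 <= cn)%E by apply: ereal_sup_ubound; left.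
have k1' : (0 < k.-1)%N by rewrite -ltnS prednK // ltnW.
have kn : k.-1%:R != 0 :> R by rewrite pnatr_eq0 -lt0n.
have : (poweR cn (k.-1%:R^-1) <= gamma%:E)%E.
  by rewrite -gE; apply: ereal_sup_ubound; exists k.
move: cn0; case: cn => [r r0| |//].
  rewrite poweR_EFin !lee_fin => H.
  have -> : r = (r `^ k.-1%:R^-1) ^+ k.-1.
    by rewrite -powR_mulrn ?powR_ge0 // -powRrM mulVf // powRr1.
  by rewrite lerXn2r // nnegrE ?powR_ge0 // ltW.
(* An infinite norm would stay infinite under the root, while [gamma] is finite. *)
by move=> _; rewrite poweRyr ?invr_eq0 // leye_eq.
Qed.

End SmaleBounds.

(** Recursion on the left summand makes [vrep] at [j'.+1] convertible to [vcons h] of [vrep] at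
    [j'], so differentiating along [h] turns each curve into the next without casts between ordinal
    types. *)
Fixpoint vrep (T : Type) (h : T) k (w : 'I_k -> T) j : 'I_(j + k) -> T :=
  match j return 'I_(j + k) -> T with
  | 0 => w
  | j'.+1 => fun i => if unlift ord0 i is Some l then vrep h w l else h
  end.

Lemma prod_vrep (R : realType) (X : normedModType R) (h : X) k (w : 'I_k -> X) j :
  \prod_(i < j + k) `|vrep h w i| = `|h| ^+ j * \prod_(i < k) `|w i|.
Proof.
elim: j => [|j IH]; first by rewrite expr0 mul1r.
rewrite exprS -mulrA -IH; exact: prod_vcons.
Qed.

Section Semilocal.
Context {R : realType} {X Y : completeNormedModType R}.
Variables (Omega : set X) (F : X -> Y) (C : set Y) (x0 : X) (gamma b : R).
Hypothesis Xrefl : reflexive_space X.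
Hypothesis F_analytic : forall x, Omega x -> analytic_at F x.
Hypothesis C_nonempty : C !=set0.
Hypothesis C_cone : closed_convex_cone C.
Hypothesis F_robinson : robinson F C x0.
Hypothesis gammaE : smale_gamma F C x0 = gamma%:E.
Hypothesis gamma_gt0 : 0 < gamma.
Hypothesis ball_Omega : ball x0 gamma^-1 `<=` Omega.
Hypothesis b_gt0 : 0 < b.
Hypothesis b_bound : (set_norm (Tinv F C x0 (- F x0)%R) <= b%:E)%E.
Hypothesis alpha_le : b * gamma <= 3 - 2 * Num.sqrt 2.

Let C0 : C 0 := cone_0 C_cone C_nonempty.
Let C_add : forall x y, C x -> C y -> C (x + y) := cone_add C_cone.
Let C_scale : forall (a : R) y, 0 <= a -> C y -> C (a *: y) :=
  cone_scale C_cone C_nonempty.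
Let C_closed : closed C. Proof. by have [] := C_cone. Qed.

Let onto y : exists d, C ('d F x0 d - y).
Proof.
have : [set: Y] y by []; rewrite -F_robinson => -[d _ [c Cc <-]].
by exists d; rewrite opprB addrC subrK.
Qed.

Let in_Omega h : gamma * `|h| < 1 -> Omega (x0 + h).
Proof.
move=> gh; apply: ball_Omega; rewrite -ball_normE /= opprD addrA subrr sub0r normrN.
by rewrite -[_^-1]mul1r ltr_pdivlMr // mulrC.
Qed.

Let derF z k : Omega z -> is_mderive (nderive F k) z (nderive F k.+1 z).
Proof.
move=> /F_analytic/analytic_nderive[rho [M [L [rho0 _ _ H]]]].
have [|+ _ _] := H k 0; first by rewrite normr0.
by rewrite addr0.
Qed.

Let mlF z k : Omega z -> multilinear (nderive F k z).
Proof.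
move=> /F_analytic/analytic_nderive[rho [M [L [rho0 _ _ H]]]].
have [|_ + _] := H k 0; first by rewrite normr0.
by rewrite addr0.
Qed.

Let diffF z : Omega z ->
  differentiable F z /\ forall d, 'd F z d = nderive F 1 z (vcons d vnil).
Proof. by move=> /derF-/(_ 0%N)/mderive_diff. Qed.

Let Omega0 : Omega x0.
Proof. by have := @in_Omega 0; rewrite normr0 mulr0 addr0; apply. Qed.

Let contF z : Omega z -> continuous ('d F z).
Proof. by move=> /diffF[/diff_locallyP[]]. Qed.

Local Notation p := (proc_norm ('d F x0) C).

Let psub : sublinear p.
Proof. exact: proc_norm_sublinear. Qed.

Let pbd : exists2 P : R, 0 <= P & forall y, p y <= P * `|y|.
Proof. by apply: proc_norm_bounded => //; exact: contF. Qed.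

(** Continuation for the curves F^(j+2)(x0 + s h)(h, ..., h, u, v) against [phi j], the [j]-th
    derivative in [s] of [2 * c / (1 - om * s) ^+ 3]. The orders start at 2 because [gamma] bounds
    no lower derivative. *)
Lemma second_derivative_bound h u v : gamma * `|h| < 1 ->
  p (nderive F 2 (x0 + h) (vcons u (vcons v vnil)))
  <= 2 * gamma / (1 - gamma * `|h|) ^+ 3 * (`|u| * `|v|).
Proof.
move=> gh; have [P P0 pP] := pbd.
pose om := gamma * `|h|; have om0 : 0 <= om by rewrite mulr_ge0 // ltW.
pose w := vcons u (vcons v (@vnil R X)).
have Pw : \prod_(i < 2) `|w i| = `|u| * `|v|.
  by rewrite !prod_vcons big_ord0 mulr1.
pose c := gamma * (`|u| * `|v|); have c0 : 0 <= c by rewrite !mulr_ge0 // ltW.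
pose gg j s := nderive F (j + 2) (x0 + s *: h) (vrep h w (j := j)).
pose phi (j : nat) (s : R) := c * (j + 2)`!%:R * om ^+ j / (1 - om * s) ^+ (j + 3).
have lt1 s : 0 <= s <= 1 -> 0 < 1 - om * s.
  move=> /andP[s0 s1]; rewrite subr_gt0; apply: le_lt_trans gh.
  by rewrite -/om -[leRHS]mulr1 ler_wpM2l.
have inO s : 0 <= s <= 1 -> Omega (x0 + s *: h).
  move=> /[dup] /lt1 + /andP[s0 _]; rewrite subr_gt0 => H; apply: in_Omega.
  by rewrite normrZ ger0_norm // mulrCA mulrC.
have := @sublinear_continuation R Y p P psub.1 psub.2 P0 pP gg phi 0 1.
have -> : 2 * gamma / (1 - gamma * `|h|) ^+ 3 * (`|u| * `|v|) = phi 0%N 1.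
  rewrite /phi /c expr0 !mulr1 -/om /= mulrAC; congr (_ / _).
  by rewrite [LHS]mulrC -[(0 + 2)`!%N]/2%N; ring.
have -> : nderive F 2 (x0 + h) w = gg 0%N 1 by rewrite /gg scale1r.
apply; last by rewrite ler01 lexx.
- move=> k s /inO Os; exact: mderive_curve (derF (k + 2) Os).
- move=> k s /lt1 Os; apply: is_derive_curve_deriv.
  apply: is_derive_eq (is_derive_invr_exp _ _ (lt0r_neq0 Os)) _.
  rewrite /phi -[(k.+1 + 2)%N]/((k + 2).+1) -[(k.+1 + 3)%N]/((k + 3).+1).
  rewrite [(k + 3)%N]addnS factS natrM (exprS om); congr (_ / _); ring.
- by move=> k s /lt1 Os; rewrite divr_ge0 ?mulr_ge0 ?exprn_ge0 // ltW.
- move=> s /inO /F_analytic/analytic_nderive[rho [M [L [rho0 M0 L0 H]]]].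
  have h1 : 0 < `|h| + 1 by rewrite ltr_wpDl.
  exists (rho / (`|h| + 1)), (M * 8 * L ^+ 2 * (`|u| * `|v|)), (2 * L * `|h|).
  split; rewrite ?divr_gt0 ?mulr_ge0 ?exprn_ge0 //.
  move=> k s' /andP[ss' s'd] _.
  have ds : `|(s' - s) *: h| < rho.
    rewrite normrZ ger0_norm ?subr_ge0 //.
    have : s' - s < rho / (`|h| + 1) by rewrite ltrBlDl.
    rewrite ltr_pdivlMr //; apply: le_lt_trans.
    by rewrite ler_wpM2l ?subr_ge0 // lerDl.
  have [_ _ /(_ (vrep h w (j := k)))] := H (k + 2)%N _ ds.
  rewrite -addrA -scalerDl [s + _]addrC subrK prod_vrep Pw => /le_trans; apply.
  (* The continuation lemma expects the factorial of [k], while the local bound gives that of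
     [k + 2]; the ratio is absorbed into the constants [8] and [2 ^+ k]. *)
  have kk : (k + 2)`!%:R <= 8 * 2 ^+ k * k`!%:R :> R.
    rewrite -natrX -!natrM ler_nat -(@bin_fact (k + 2) 2) ?leq_addl // addnK.
    rewrite mulnA leq_mul2r; apply/orP; right.
    apply: leq_trans (_ : 2 ^ (k + 2) * 2 <= _)%N; first by rewrite leq_mul2r leq_bin_exp2 orbT.
    by rewrite expnD -!mulnA mulnC.
  have -> : M * 8 * L ^+ 2 * (`|u| * `|v|) * k`!%:R * (2 * L * `|h|) ^+ k =
    (8 * 2 ^+ k * k`!%:R) * (M * L ^+ (k + 2) * (`|h| ^+ k * (`|u| * `|v|))).
    by rewrite exprD !exprMn; ring.
  have -> : M * (k + 2)`!%:R * L ^+ (k + 2) * (`|h| ^+ k * (`|u| * `|v|)) =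
    (k + 2)`!%:R * (M * L ^+ (k + 2) * (`|h| ^+ k * (`|u| * `|v|))) by ring.
  by rewrite ler_wpM2r // !mulr_ge0 // exprn_ge0.
(* At [s = 0] the majorants are exactly the bounds that [gamma] provides. *)
- move=> k; rewrite /gg /phi scale0r addr0 mulr0 subr0 expr1n divr1.
  apply: le_trans (smale_gamma_bound onto C0 C_add C_scale _ gamma_gt0 gammaE _ _) _.
  + by rewrite addn2.
  + exact: mlF.
  rewrite prod_vrep Pw addn2 /= /c /om exprMn exprS.
  by rewrite le_eqVlt; apply/orP; left; apply/eqP; ring.
Qed.

Let derF_opp z u : Omega z ->
  nderive F 1 z (vcons (- u) vnil) = - 'd F z u.
Proof. by move=> Oz; rewrite -linearN (diffF Oz).2. Qed.

(** Integrates the second derivative along the segment in the directions [h] and [- v], the sign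
    being forced by the order of the difference. The factor is the increase of [f'] from 0 to
    |h|. *)
Lemma first_derivative_bound h v : gamma * `|h| < 1 ->
  p ('d F x0 v - 'd F (x0 + h) v) <= ((1 - gamma * `|h|) ^- 2 - 1) * `|v|.
Proof.
move=> gh; have [P P0 pP] := pbd.
pose om := gamma * `|h|; have om0 : 0 <= om by rewrite mulr_ge0 // ltW.
have lt1 s : 0 <= s <= 1 -> 0 < 1 - om * s.
  move=> /andP[s0 s1]; rewrite subr_gt0; apply: le_lt_trans gh.
  by rewrite -/om -[leRHS]mulr1 ler_wpM2l.
have sh s : 0 <= s <= 1 -> gamma * `|s *: h| = om * s.
  by move=> /andP[s0 _]; rewrite normrZ ger0_norm // mulrCA mulrC.
have inO s : 0 <= s <= 1 -> Omega (x0 + s *: h).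
  by move=> s01; apply: in_Omega; rewrite sh // -subr_gt0 lt1.
pose u s := nderive F 1 (x0 + s *: h) (vcons (- v) vnil) + 'd F x0 v.
pose u' s := nderive F 2 (x0 + s *: h) (vcons h (vcons (- v) vnil)) + 0.
pose psi (s : R) := `|v| / (1 - om * s) ^+ 2 + - `|v|.
pose psi' (s : R) := `|v| * 2 * om / (1 - om * s) ^+ 3 + 0.
have := @sublinear_mvi R Y p P psub.1 psub.2 P0 pP u u' psi psi' 0 1.
move=> /(_ _ _ _ _ 1) H.
have -> : 'd F x0 v - 'd F (x0 + h) v = u 1.
  by rewrite /u scale1r (derF_opp _ (in_Omega gh)) [RHS]addrC.
have -> : ((1 - gamma * `|h|) ^- 2 - 1) * `|v| = psi 1.
  by rewrite /psi mulr1 mulrBl mul1r mulrC.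
apply: H; last by rewrite ler01 lexx.
- move=> s s01; apply: curve_derivD; last exact: curve_deriv_cst.
  exact: mderive_curve (derF 1 (inO s s01)).
- move=> s s01; apply: curve_derivD; last exact: (@curve_deriv_cst _ R^o).
  by apply: is_derive_curve_deriv; apply: is_derive_invr_exp; rewrite gt_eqF // lt1.
- rewrite /u /psi scale0r addr0 derF_opp // addNr (sublinear0 psub).
  by rewrite mulr0 subr0 expr1n divr1 subrr.
- move=> s s01; rewrite /u' /psi' !addr0.
  apply: le_trans (second_derivative_bound _ _ _) _; rewrite sh //.
    by rewrite -subr_gt0 lt1.
  by rewrite normrN le_eqVlt; apply/orP; left; apply/eqP; rewrite /om; ring.
Qed.

Lemma taylor_remainder_bound h d : gamma * (`|h| + `|d|) < 1 ->
  p (- (F (x0 + h + d) - F (x0 + h) - 'd F (x0 + h) d))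
  <= gamma * `|d| ^+ 2 / ((1 - gamma * `|h|) ^+ 2 * (1 - gamma * (`|h| + `|d|))).
Proof.
move=> ghd; have [P P0 pP] := pbd; set z := x0 + h.
pose a := 1 - gamma * `|h|.
have gd : 0 <= gamma * `|d| by rewrite mulr_ge0 // ltW.
have a0 : gamma * `|d| < a by rewrite /a ltrBrDl -mulrDr.
have a_gt0 : 0 < a by exact: le_lt_trans a0.
(* With this [w], the quantity [1 - gamma * (|h| + s * |d|)] factors as [a * (1 - w * s)], the shape
   handled by [is_derive_invr_exp]. *)
pose w := gamma * `|d| / a.
have w0 : 0 <= w by rewrite divr_ge0 // ltW.
have w1 : w < 1 by rewrite ltr_pdivrMr // mul1r.
have wa : gamma * `|d| = w * a by rewrite divfK // gt_eqF.
have lt1 s : 0 <= s <= 1 -> 0 < 1 - w * s.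
  by move=> /andP[s0 s1]; rewrite subr_gt0; apply: le_lt_trans w1; rewrite -[leRHS]mulr1 ler_wpM2l.
have sd s : 0 <= s <= 1 -> a * (1 - w * s) <= 1 - gamma * `|h + s *: d|.
  move=> /andP[s0 _]; rewrite mulrBr mulr1 mulrA [a * w]mulrC -wa /a -addrA -opprD lerD2l lerN2.
  rewrite -mulrA -mulrDr ler_wpM2l ?(ltW gamma_gt0) //.
  by apply: le_trans (ler_normD _ _) _; rewrite normrZ ger0_norm // [s * _]mulrC.
have lt2 s : 0 <= s <= 1 -> gamma * `|h + s *: d| < 1.
  move=> s01; rewrite -subr_gt0; apply: lt_le_trans (sd s s01).
  by rewrite mulr_gt0 // lt1.
have inO s : 0 <= s <= 1 -> Omega (z + s *: d).
  by move=> s01; rewrite /z -addrA; apply: in_Omega; exact: lt2.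
have Oz : Omega z by have := @inO 0; rewrite scale0r addr0; apply; rewrite lexx ler01.
pose u1 s := nderive F 1 (z + s *: d) (vcons (- d) vnil) + 'd F z d.
pose u2 s := nderive F 2 (z + s *: d) (vcons d (vcons (- d) vnil)) + 0.
pose K := `|d| / a ^+ 2.
have K0 : 0 <= K by rewrite divr_ge0 // exprn_ge0 // ltW.
pose psi1 (s : R) := K / (1 - w * s) ^+ 2 + - K.
pose psi2 (s : R) := K * 2 * w / (1 - w * s) ^+ 3 + 0.
have u1b : forall s, 0 <= s <= 1 -> p (u1 s) <= psi1 s.
  apply: (@sublinear_mvi R Y p P psub.1 psub.2 P0 pP u1 u2 psi1 psi2 0 1).
  - move=> s s01; apply: curve_derivD; last exact: curve_deriv_cst.
    exact: mderive_curve (derF 1 (inO s s01)).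
  - move=> s s01; apply: curve_derivD; last exact: (@curve_deriv_cst _ R^o).
    by apply: is_derive_curve_deriv; apply: is_derive_invr_exp; rewrite gt_eqF // lt1.
  - rewrite /u1 /psi1 scale0r addr0 derF_opp // addNr (sublinear0 psub).
    by rewrite mulr0 subr0 expr1n divr1 subrr.
  - move=> s s01; rewrite /u2 /psi2 !addr0 /z -addrA.
    apply: le_trans (second_derivative_bound _ _ (lt2 s s01)) _; rewrite normrN.
    have e1 : 0 < a * (1 - w * s) by rewrite mulr_gt0 // lt1.
    have -> : K * 2 * w / (1 - w * s) ^+ 3 =
        2 * gamma * (`|d| * `|d|) / (a * (1 - w * s)) ^+ 3.
      have := lt1 s s01 => l; rewrite /K /w exprMn; field.
      rewrite !gt_eqF //=.
      by have -> : a - gamma * `|d| * s = a * (1 - w * s) by rewrite mulrBr mulr1 mulrA [a * w]mulrC -wa.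
    rewrite mulrAC ler_wpM2l ?mulr_ge0 ?(ltW gamma_gt0) //.
    rewrite lef_pV2 ?posrE ?exprn_gt0 ?(lt_le_trans e1 (sd s s01)) //.
    by rewrite lerXn2r ?nnegrE ?(ltW e1) ?sd // ltW // (lt_le_trans e1 (sd s s01)).
pose u0 s := - nderive F 0 (z + s *: d) vnil + (F z + s *: 'd F z d).
pose u1' s := - nderive F 1 (z + s *: d) (vcons d vnil) + (0 + 'd F z d).
(* The primitive of [psi1] that vanishes at 0. *)
pose psi0 (s : R) := K * w * (s ^+ 2 / (1 - w * s) ^+ 1).
have := @sublinear_mvi R Y p P psub.1 psub.2 P0 pP u0 u1' psi0 psi1 0 1.
move=> /(_ _ _ _ _ 1) H.
have -> : - (F (z + d) - F z - 'd F z d) = u0 1.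
  by rewrite /u0 /= !scale1r !opprD !opprK addrA.
have -> : gamma * `|d| ^+ 2 / ((1 - gamma * `|h|) ^+ 2 * (1 - gamma * (`|h| + `|d|))) = psi0 1.
  have l := @lt1 1; rewrite mulr1 in l.
  have -> : 1 - gamma * (`|h| + `|d|) = a * (1 - w).
    by rewrite mulrBr mulr1 [a * w]mulrC -wa /a mulrDr opprD addrA.
  rewrite -/a /psi0 /K !mulr1 !expr1 expr1n.
  have l' : 1 - w != 0 by rewrite gt_eqF // l // ler01 lexx.
  have -> : gamma * `|d| ^+ 2 = w * a * `|d| by rewrite -wa; ring.
  by field; rewrite l' gt_eqF.
apply: H; last by rewrite ler01 lexx.
- move=> s s01; apply: curve_derivD.
    by apply: curve_derivN; exact: mderive_curve (derF 0 (inO s s01)).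
  by apply: curve_derivD; [exact: curve_deriv_cst | exact: curve_deriv_lin].
- move=> s s01; apply: is_derive_curve_deriv.
  have l := lt0r_neq0 (lt1 s s01); have dd := is_derive_invr_exp 1 1 l.
  have -> : psi0 = (K * w) *: ((@id R) ^+ 2 * (fun y => 1 / (1 - w * y) ^+ 1))%R.
    by apply/funext => y; rewrite !fctE /psi0 !expr1 div1r.
  apply: is_derive_eq; rewrite /psi1 /GRing.scale /= !fctE !expr1.
  by field.
- rewrite /u0 /psi0 scale0r addr0 scale0r addr0 /= addNr (sublinear0 psub).
  by rewrite expr0n /= mul0r mulr0.
- move=> s s01; have := u1b s s01; rewrite /u1 /u1' add0r derF_opp ?(diffF (inO s s01)).2 //.
  exact: inO.
Qed.

(** * Newton directions, their lengths and the limit *)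

Local Notation f := (majorant gamma b).
Local Notation ts := (tstar gamma b).
Local Notation tk := (real_newton f 0).
(** This is [- f' t], in the form of [step_derive1]. *)
Local Notation beta t := ((2 * (1 - gamma * t) ^+ 2 - 1) / (1 - gamma * t) ^+ 2).

Let gts : gamma * ts < 1.
Proof. by rewrite mulrC -ltr_pdivlMr // div1r; exact: tstar_lt. Qed.

Let a_gt0 t : t < ts -> 0 < 1 - gamma * t.
Proof. by move=> h; rewrite subr_gt0; apply: lt_trans gts; rewrite ltr_pM2l. Qed.

Let beta_gt0 t : t < ts -> 0 < beta t.
Proof.
move=> h; rewrite divr_gt0 ?exprn_gt0 ?a_gt0 //.
exact: (step_sq_gt gamma_gt0 alpha_le h).
Qed.

Let in_Omega_ts x : `|x - x0| <= ts -> Omega x.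
Proof.
move=> h; rewrite -(subrK x0 x) addrC; apply: in_Omega.
by apply: le_lt_trans gts; rewrite ler_pM2l.
Qed.

Let x0_sub x : x0 + (x - x0) = x. Proof. by rewrite addrC subrK. Qed.

(** Perturbation with [theta = (1 - gamma * t) ^- 2 - 1], for which [1 - theta] is [beta t]; it is
    below 1 precisely because [t < ts] makes [beta t] positive. *)
Lemma newton_process_solvable x t y K : `|x - x0| <= t -> t < ts ->
  p y < K * beta t -> exists2 D, C ('d F x D - y) & `|D| <= K.
Proof.
move=> xt tts yK; have a0 := a_gt0 tts.
have t0 : 0 <= t by exact: le_trans (normr_ge0 _) xt.
have a2 : 0 < (1 - gamma * t) ^+ 2 by rewrite exprn_gt0.
have Ox : Omega x by apply: in_Omega_ts; exact: le_trans xt (ltW tts).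
have bE : beta t = 1 - ((1 - gamma * t) ^- 2 - 1) by field; rewrite gt_eqF.
have a1 : 1 <= (1 - gamma * t) ^- 2.
  by rewrite invf_ge1 // expr_le1 ?(ltW a0) // gerBl mulr_ge0 // ltW.
have th0 : 0 <= (1 - gamma * t) ^- 2 - 1 by rewrite subr_ge0.
have th1 : (1 - gamma * t) ^- 2 - 1 < 1.
  by have := beta_gt0 tts; rewrite bE subr_gt0.
have Hth v : p ('d F x0 v - 'd F x v) <= ((1 - gamma * t) ^- 2 - 1) * `|v|.
  have gx : gamma * `|x - x0| <= gamma * t by rewrite ler_pM2l.
  have g1 : gamma * `|x - x0| < 1.
    by apply: le_lt_trans gx _; rewrite -subr_gt0.
  have := first_derivative_bound v g1; rewrite x0_sub => /le_trans; apply.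
  have aa : 1 - gamma * t <= 1 - gamma * `|x - x0| by rewrite lerD2l lerN2.
  have a0' := lt_le_trans a0 aa.
  apply: ler_wpM2r => //; rewrite lerD2r lef_pV2 ?posrE ?exprn_gt0 //.
  by apply: lerXn2r => //; rewrite nnegrE; exact: ltW.
rewrite bE in yK.
exact: (proc_perturbation (contF Omega0) C0 C_add C_closed onto (contF Ox) th0 Hth yK th1).
Qed.

Lemma newton_dirs_nonempty x : `|x - x0| < ts -> newton_dirs F C x !=set0.
Proof.
move=> xts; have Ox : Omega x by apply: in_Omega_ts; exact: ltW.
apply: reflexive_argmin_norm => //.
- have -> : [set d | C (F x + 'd F x d)] = (fun d => F x + 'd F x d) @^-1` C by [].
  apply: closed_comp => // d _.
  by apply: continuousD; [exact: cst_continuous | exact: contF].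
- have bt := beta_gt0 xts.
  have [|D CD _] := @newton_process_solvable x _ (- F x) ((p (- F x) + 1) / beta `|x - x0|) (lexx _) xts.
    by rewrite divfK ?gt_eqF // ltrDl.
  by exists D; rewrite /= addrC -[F x]opprK.
- move=> d e a /andP[a0 a1] Cd Ce /=.
  have -> : F x + 'd F x (a *: d + (1 - a) *: e) =
      a *: (F x + 'd F x d) + (1 - a) *: (F x + 'd F x e).
    rewrite linearD !linearZ !scalerDr addrACA -scalerDl.
    by rewrite [a + _]addrC subrK scale1r.
  by apply: C_add; apply: C_scale => //; rewrite subr_ge0.
Qed.

(** [y] is left free, subject to its solutions being admissible directions: it is [- F x0] at the
    first step and a Taylor remainder afterwards. *)
Lemma newton_dir_le x t y kappa d : `|x - x0| <= t -> t < ts -> p y <= kappa ->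
  (forall D, C ('d F x D - y) -> C (F x + 'd F x D)) ->
  newton_dirs F C x d -> `|d| <= kappa / beta t.
Proof.
move=> xt tts yk H [_ dmin]; apply/ler_addgt0Pr => e e0.
have bt := beta_gt0 tts.
have [|D CD DK] := @newton_process_solvable x t y (kappa / beta t + e) xt tts.
  by apply: le_lt_trans yk _; rewrite mulrDl divfK ?gt_eqF // ltrDl mulr_gt0.
by apply: le_trans (dmin D (H D CD)) DK.
Qed.

Lemma newton_first_step d : newton_dirs F C x0 d -> `|d| <= b.
Proof.
move=> dN; have ts0 := tstar_gt0 gamma_gt0 b_gt0 alpha_le.
have := @newton_dir_le x0 0 (- F x0) b d; rewrite subrr normr0 => /(_ (lexx _) ts0).
have -> : b / beta 0 = b by rewrite mulr0 subr0 expr1n; field.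
apply=> //; first exact: proc_norm_set_norm.
by move=> D; rewrite opprK addrC.
Qed.

Lemma newton_next_step x d d' t t' : 0 <= t -> `|x - x0| <= t -> `|d| <= t' - t ->
  t' < ts -> newton_dirs F C x d -> newton_dirs F C (x + d) d' ->
  `|d'| <= gamma * `|d| ^+ 2 / ((1 - gamma * t) ^+ 2 * (1 - gamma * t')) / beta t'.
Proof.
move=> t0 xt dt t'ts [Cd _] dN'.
have tt' : t <= t' by rewrite -subr_ge0; exact: le_trans (normr_ge0 _) dt.
have xdt : `|x + d - x0| <= t'.
  rewrite addrAC; apply: le_trans (ler_normD _ _) _.
  by apply: le_trans (lerD xt dt) _; rewrite addrC subrK.
apply: (@newton_dir_le (x + d) t' (- (F (x + d) - F x - 'd F x d))) => //; last first.
  (* The inclusion satisfied by the previous direction is added to that of [D]; the terms [F x] and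
     ['d F x d] cancel. *)
  move=> D CD; have := C_add CD Cd.
  have cancel (q r u v : Y) : q + r = r - - (q - u - v) + (u + v).
    by rewrite opprK -[q - u - v]addrA -opprD -addrA subrK addrC.
  by rewrite -cancel.
have sum_le : `|x - x0| + `|d| <= t'.
  by apply: le_trans (lerD xt dt) _; rewrite addrC subrK.
have g1 : gamma * (`|x - x0| + `|d|) <= gamma * t' by rewrite ler_pM2l.
have g2 : gamma * `|x - x0| <= gamma * t by rewrite ler_pM2l.
have a1 := a_gt0 t'ts; have a2 := a_gt0 (le_lt_trans tt' t'ts).
have := @taylor_remainder_bound (x - x0) d; rewrite x0_sub => /(_ _)/le_trans; apply.
  by apply: le_lt_trans g1 _; rewrite -subr_gt0.
rewrite ler_wpM2l ?mulr_ge0 ?exprn_ge0 ?(ltW gamma_gt0) //.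
have a3 : 1 - gamma * t' <= 1 - gamma * (`|x - x0| + `|d|) by rewrite lerD2l lerN2.
have a4 : 1 - gamma * t <= 1 - gamma * `|x - x0| by rewrite lerD2l lerN2.
have a5 := lt_le_trans a1 a3; have a6 := lt_le_trans a2 a4.
rewrite lef_pV2 ?posrE ?mulr_gt0 ?exprn_gt0 //.
apply: ler_pM => //; [by rewrite exprn_ge0 // ltW | exact: ltW |].
by apply: lerXn2r => //; rewrite nnegrE; exact: ltW.
Qed.

Let tkb k : 0 <= tk k < ts := real_newton_bounds gamma_gt0 b_gt0 alpha_le k.
Let tk0 k : 0 <= tk k. Proof. by have /andP[] := tkb k. Qed.
Let tkts k : tk k < ts. Proof. by have /andP[] := tkb k. Qed.
Let tkS k : tk k < tk k.+1 := real_newton_inc gamma_gt0 b_gt0 alpha_le k.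

Lemma newton_quadratic_step x d d' k : `|x - x0| <= tk k -> `|d| <= tk k.+1 - tk k ->
  newton_dirs F C x d -> newton_dirs F C (x + d) d' ->
  `|d'| <= (tk k.+2 - tk k.+1) / (tk k.+1 - tk k) ^+ 2 * `|d| ^+ 2.
Proof.
move=> xt dt dN dN'.
apply: le_trans (newton_next_step (tk0 k) xt dt (tkts k.+1) dN dN') _.
rewrite (real_newton_stepS gamma_gt0 b_gt0 alpha_le).
have D0 : 0 < tk k.+1 - tk k by rewrite subr_gt0.
have a1 := a_gt0 (tkts k); have a2 := a_gt0 (tkts k.+1).
move: (beta_gt0 (tkts k.+1)) D0; set B := beta _ => B0.
move: (tk k.+1 - tk k) => D D0; rewrite le_eqVlt; apply/orP; left; apply/eqP.
by field; rewrite !gt_eqF.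
Qed.

(** Stated for finite runs, since the nonemptiness of the next argmin set must follow from the
    iterates already built. Distance and step bounds advance together: each next step uses both. *)
Lemma newton_run_bounds n x : newton_run F C x0 n x -> forall k,
  ((k <= n)%N -> `|x k - x0| <= tk k) /\
  ((k < n)%N -> `|x k.+1 - x k| <= tk k.+1 - tk k).
Proof.
move=> [x00 run]; elim=> [|k [IH1 IH2]].
  split=> [_|n0]; first by rewrite x00 subrr normr0.
  have [d dN ->] := run 0%N n0; rewrite x00 addrAC subrr add0r.
  rewrite (real_newton_step1 gamma_gt0 b_gt0 alpha_le) subr0.
  by apply: newton_first_step; rewrite -x00.
have H1 : (k.+1 <= n)%N -> `|x k.+1 - x0| <= tk k.+1.
  move=> kn; rewrite -(subrK (x k) (x k.+1)) -addrA.
  apply: le_trans (ler_normD _ _) _.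
  by apply: le_trans (lerD (IH2 kn) (IH1 (ltnW kn))) _; rewrite subrK.
split=> // kn; have kn' := ltnW kn.
have [d dN xd] := run k kn'; have [d' dN' xd'] := run k.+1 kn.
have dE : x k.+1 - x k = d by rewrite xd addrAC subrr add0r.
have dle : `|d| <= tk k.+1 - tk k by rewrite -dE; exact: IH2.
rewrite xd' addrAC subrr add0r.
rewrite xd in dN'.
apply: le_trans (newton_quadratic_step (IH1 (ltnW kn')) dle dN dN') _.
have D0 : 0 < tk k.+1 - tk k by rewrite subr_gt0.
have D1 : 0 < tk k.+2 - tk k.+1 by rewrite subr_gt0.
(* The quadratic estimate implies the linear one, the squared ratio of the previous steps being at
   most 1. *)
rewrite mulrAC -mulrA ler_piMr ?(ltW D1) // ler_pdivrMr ?exprn_gt0 // mul1r.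
by rewrite lerXn2r ?nnegrE ?(ltW D0).
Qed.

Lemma newton_run_quadratic n x k : newton_run F C x0 n x -> (k.+1 < n)%N ->
  `|x k.+2 - x k.+1| <=
    (tk k.+2 - tk k.+1) / (tk k.+1 - tk k) ^+ 2 * `|x k.+1 - x k| ^+ 2.
Proof.
move=> run kn; have kn' := ltnW kn; have [_ st] := run.
have [B1 B2] := newton_run_bounds run k.
have [d dN xd] := st k kn'; have [d' dN' xd'] := st k.+1 kn.
have dE : x k.+1 - x k = d by rewrite xd addrAC subrr add0r.
have -> : x k.+2 - x k.+1 = d' by rewrite xd' addrAC subrr add0r.
rewrite dE; rewrite xd in dN'.
apply: newton_quadratic_step dN dN'; first exact: B1 (ltnW kn').
by rewrite -dE; exact: B2.
Qed.

Lemma newton_seq_limit x : newton_seq F C x0 x -> exists xs : X,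
  [/\ x @ \oo --> xs, `|xs - x0| <= ts, C (F xs) & forall k, `|xs - x k| <= ts - tk k].
Proof.
move=> xN.
have xb k : `|x k - x0| <= tk k by have [+ _] := newton_run_bounds (xN k) k; apply.
have xd k : `|x k.+1 - x k| <= tk k.+1 - tk k.
  by have [_ +] := newton_run_bounds (xN k.+1) k; apply.
have [||D [sD _]] := @series_geometric_bound R X (fun k => x k.+1 - x k) ts 2^-1.
- by rewrite invr_ge0 ler0n /= invf_lt1 // ltr1n.
- move=> k; apply: le_trans (xd k) _.
  apply: le_trans (real_newton_geometric gamma_gt0 b_gt0 alpha_le k).
  by rewrite lerD2r ltW.
have sE : series (fun k => x k.+1 - x k) = fun n => x n - x 0%N.
  by apply/funext => n; rewrite /series /= telescope_sumr.
pose xs := D + x 0%N; have xc : x @ \oo --> xs.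
  have -> : x = fun n => (x n - x 0%N) + x 0%N by apply/funext => n; rewrite subrK.
  by apply: cvgD; [rewrite -sE | exact: cvg_cst].
have xmn k n : (k <= n)%N -> `|x n - x k| <= tk n - tk k.
  move=> /subnKC <-; elim: (n - k)%N => [|m IH].
    by rewrite addn0 !subrr normr0.
  rewrite addnS -(subrK (x (k + m)%N) (x (k + m).+1)) -addrA.
  apply: le_trans (ler_normD _ _) _; apply: le_trans (lerD (xd _) IH) _.
  by rewrite addrA subrK.
have err k : `|xs - x k| <= ts - tk k.
  apply: (cvg_norm_sub_le xc (m := k)) => n /xmn H; apply: le_trans H _.
  by rewrite lerD2r ltW.
have xsb : `|xs - x0| <= ts.
  apply: (cvg_norm_sub_le xc (m := 0%N)) => n _; apply: le_trans (xb n) _; exact: ltW.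
(* The limit may lie on the sphere of radius [ts], which is still inside the open ball of radius
   [1 / gamma]. *)
have Oxs := in_Omega_ts xsb.
exists xs; split=> //.
have [rho [M [L [rho0 M0 L0 H]]]] := analytic_nderive (F_analytic Oxs).
have dx0 : (fun k => x k.+1 - x k) @ \oo --> (0 : X).
  rewrite -(subrr xs); apply: cvgB => //; by rewrite (cvg_shiftS x).
(* The Newton inclusions pass to the limit in the closed set [C]: near [xs] the differentials are
   bounded by [M * L] and the steps tend to 0, so the linear term disappears. *)
apply: (@closed_cvg _ _ \oo _ (fun k => F (x k) + 'd F (x k) (x k.+1 - x k)) C) => //.
  apply: nearW => k; have [_ st] := xN k.+1.
  have [d [Cd _] ->] := st k (ltnSn k).
  by rewrite addrAC subrr add0r.
rewrite -[X in _ --> X](addr0 (F xs)); apply: cvgD.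
  apply: (@continuous_cvg _ _ _ \oo _ x F xs) => //.
  by apply: differentiable_continuous; exact: (diffF Oxs).1.
apply/norm_cvg0P.
apply: (@squeeze_cvgr _ _ _ _ (cst 0) (fun k => M * L * `|x k.+1 - x k|)).
- near=> k; rewrite normr_ge0 /=.
  have Oxk : Omega (x k) by apply: in_Omega_ts; apply: le_trans (xb k) _; exact: ltW.
  have xk : `|x k - xs| < rho.
    by near: k; apply: cvgr_distC_lt.
  rewrite (diffF Oxk).2.
  have [_ _ /(_ (vcons (x k.+1 - x k) vnil))] := H 1%N _ xk.
  by rewrite prod_vcons big_ord0 mulr1 expr1 mulr1 addrC subrK.
- exact: cvg_cst.
- rewrite -[X in _ --> X](mulr0 (M * L)); apply: cvgMr.
  by rewrite -(normr0 X); apply: cvg_norm.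
Unshelve. all: by end_near. Qed.

End Semilocal.

Lemma limn_esup_half (R : realType) (V : normedModType R) (u : nat -> V) l :
  (forall k, `|l - u k.+1| <= 2^-1 * `|l - u k|) ->
  (limn_esup (err_quotient 1 u l) < 1)%E.
Proof.
move=> H; apply: (@le_lt_trans _ _ (2^-1)%:E).
  by apply: limn_esup_err_quotient_le; rewrite ?invr_ge0 //; apply: nearW => k; rewrite expr1.
by rewrite lte_fin invf_lt1 // ltr1n.
Qed.

Theorem theorem21 (R : realType) (X Y : completeNormedModType R)
    (Xrefl : reflexive_space X)
    (Omega : set X) (F : X -> Y) (C : set Y) (x0 : X) (gamma b : R)
    (Omega_open : open Omega)
    (F_analytic : forall x, Omega x -> analytic_at F x)
    (C_nonempty : C !=set0)
    (C_cone : closed_convex_cone C)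
    (x0_Omega : Omega x0)
    (F_robinson : robinson F C x0)
    (gammaE : smale_gamma F C x0 = gamma%:E)
    (gamma_gt0 : 0 < gamma)
    (ball_Omega : ball x0 gamma^-1 `<=` Omega)
    (b_gt0 : 0 < b)
    (b_bound : (set_norm (Tinv F C x0 (- F x0)%R) <= b%:E)%E)
    (alpha_le : b * gamma <= 3 - 2 * Num.sqrt 2) :
  let f := majorant gamma b in
  let ts := tstar gamma b in
  let t := real_newton f 0 in
  let K := quad_const gamma ts in
  [/\ smallest_zero_on `[0, gamma^-1[ f ts,
      (forall k, 0 <= t k < gamma^-1 /\ derive1 f (t k) != 0),
      (forall n x, newton_run F C x0 n x ->
         Omega (x n) /\ newton_dirs F C (x n) !=set0),
      [/\ forall k, t k < t k.+1,
          forall k, 0 <= t k < ts,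
          (t @ \oo --> ts),
          forall k, ts - t k.+1 <= 2^-1 * (ts - t k) &
          Q_linear (t : nat -> R^o) ts] &
      (b * gamma < 3 - 2 * Num.sqrt 2 ->
        (forall k, t k.+2 - t k.+1 <= K * (t k.+1 - t k) ^+ 2) /\
        (forall k, ts - t k.+1 <= K * (ts - t k) ^+ 2))] /\
  (forall x : nat -> X, newton_seq F C x0 x ->
    [/\ forall k, ball x0 ts (x k),
        forall k, `|x k.+1 - x k| <= t k.+1 - t k,
        forall k, `|x k.+2 - x k.+1|
          <= (t k.+2 - t k.+1) / (t k.+1 - t k) ^+ 2 * `|x k.+1 - x k| ^+ 2 &
        exists xs : X,
          [/\ (x @ \oo --> xs),
              closed_ball_ Num.norm x0 ts xs,
              C (F xs),
              (forall k, `|xs - x k| <= ts - t k) /\ R_linear x xs &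
              (b * gamma < 3 - 2 * Num.sqrt 2 ->
                (forall k, `|x k.+2 - x k.+1| <= K * `|x k.+1 - x k| ^+ 2) /\
                (limn_esup (err_quotient 2 x xs) <= K%:E)%E)]]).
Proof.
move=> f ts t K.
have tb := real_newton_bounds gamma_gt0 b_gt0 alpha_le.
have t0 k : 0 <= t k by have /andP[] := tb k.
have tts k : t k < ts by have /andP[] := tb k.
have thalf := real_newton_half gamma_gt0 b_gt0 alpha_le.
have tcvg := real_newton_cvg gamma_gt0 b_gt0 alpha_le.
have nts k : `|ts - t k| = ts - t k by rewrite gtr0_norm // subr_gt0.
have tsg : ts < gamma^-1 by exact: tstar_lt.
have inO x : `|x - x0| < ts -> Omega x.
  move=> h; apply: ball_Omega; rewrite -ball_normE /= distrC.
  exact: lt_trans h tsg.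
have bounds n x k : newton_run F C x0 n x ->
    ((k <= n)%N -> `|x k - x0| <= t k) /\
    ((k < n)%N -> `|x k.+1 - x k| <= t k.+1 - t k).
  move=> run; exact: (newton_run_bounds (Omega := Omega) (x0 := x0) (F := F) (C := C)).
split.
  split.
  - exact: majorant_smallest_zero.
  - move=> k; rewrite t0 (lt_trans (tts k)) //; split=> //.
    exact: (step_derive1_neq0 gamma_gt0 alpha_le (tts k)).
  - move=> n x run; have [/(_ (leqnn n)) xn _] := bounds n x n run.
    have xts := le_lt_trans xn (tts n); split; first exact: inO.
    exact: (newton_dirs_nonempty (Omega := Omega) (b := b) (gamma := gamma) (x0 := x0)).
  - split=> //; first exact: real_newton_inc.
    split=> //; apply: limn_esup_half => k.
    by rewrite (nts k.+1) (nts k); exact: thalf.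
  - move=> hs; split=> k; first exact: real_newton_step_quad.
    exact: real_newton_quad.
move=> x xN.
have xb k : `|x k - x0| <= t k by have [+ _] := bounds k x k (xN k); apply.
have xd k : `|x k.+1 - x k| <= t k.+1 - t k.
  by have [_ +] := bounds k.+1 x k (xN k.+1); apply.
have xq k : `|x k.+2 - x k.+1|
    <= (t k.+2 - t k.+1) / (t k.+1 - t k) ^+ 2 * `|x k.+1 - x k| ^+ 2.
  have run := xN k.+2; have k2 := ltnSn k.+1.
  exact: (newton_run_quadratic (Omega := Omega) (x0 := x0) (F := F) (C := C)).
have [xs [xc xsb Cxs err]] : exists xs : X, [/\ x @ \oo --> xs, `|xs - x0| <= ts, C (F xs) &
    forall k, `|xs - x k| <= ts - t k].
  exact: (newton_seq_limit (Omega := Omega) (x0 := x0) (F := F) (C := C)).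
split=> //.
  by move=> k; rewrite -ball_normE /= distrC; exact: le_lt_trans (xb k) (tts k).
exists xs; split=> //.
- by rewrite /closed_ball_ /= distrC.
(* The scalar errors dominate those of [x] and are halved at each step. *)
- split=> //; exists (fun k => ts - t k); split=> //; split.
    rewrite -(subrr ts); apply: cvgB => //; exact: cvg_cst.
  apply: limn_esup_half => k; by rewrite !sub0r !normrN (nts k.+1) (nts k); exact: thalf.
- move=> hs.
  have K0 : 0 < K by exact: quad_const_gt0.
  have xK k : `|x k.+2 - x k.+1| <= K * `|x k.+1 - x k| ^+ 2.
    apply: le_trans (xq k) _; rewrite ler_wpM2r ?exprn_ge0 //.
    have tS : t k < t k.+1 by exact: real_newton_inc.
    rewrite ler_pdivrMr ?exprn_gt0 ?subr_gt0 //.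
    exact: real_newton_step_quad.
  by split=> //; exact: quadratic_steps_limn_esup.
Qed.
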